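(* Let $\Omega \subset \mathbb{R}^d$ be a convex, non-symmetric, bounded open set of Lebesgue measure $1$. Then $\Omega$ is not spectral.
   Context: A set $\Omega \subset \mathbb{R}^d$ is symmetric with respect to $x_0 \in \mathbb{R}^d$ if $y \in \Omega$ implies $2x_0 - y \in \Omega$. It is called non-symmetric if it is not symmetric with respect to any $x_0 \in \mathbb{R}^d$. For $\lambda \in \mathbb{R}^d$ write $e_\lambda(x) = \exp(2\pi i \langle \lambda, x\rangle)$, $x \in \mathbb{R}^d$. The space $L^2(\Omega)$ carries the inner product $\langle f, g\rangle_\Omega = \int_\Omega f \overline{g}$. A measurable set $\Omega \subset \mathbb{R}^d$ of Lebesgue measure $1$ is called spectral if there is a discrete set $\Lambda \subset \mathbb{R}^d$ such that $E_\Lambda = \{ e_\lambda : \lambda \in \Lambda\}$ is an orthonormal basis of $L^2(\Omega)$. *)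

(* Defs.v *)
From HB Require Import structures.
From mathcomp Require Import all_boot all_order all_algebra.
From mathcomp Require Import complex.
From mathcomp Require Import all_classical all_reals all_analysis.

Set Implicit Arguments.
Unset Strict Implicit.
Unset Printing Implicit Defensive.

Import Order.TTheory GRing.Theory Num.Theory.
Import numFieldNormedType.Exports.

Local Open Scope classical_set_scope.
Local Open Scope ring_scope.

Definition measure_rV_display : measure_display -> measure_display.
Proof. exact. Qed.

Section measurable_rV.
Context {d} {T : sigmaRingType d}.
Variable n : nat.

Let coors : 'I_n -> 'rV[T]_n -> T := fun i v => v ord0 i.

Let rV_set0 : g_sigma_preimage coors set0.
Proof. exact: sigma_algebra0. Qed.

Let rV_setC A : g_sigma_preimage coors A -> g_sigma_preimage coors (~` A).
Proof. exact: sigma_algebraC. Qed.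

Let rV_bigcup (F : _^nat) : (forall i, g_sigma_preimage coors (F i)) ->
  g_sigma_preimage coors (\bigcup_i (F i)).
Proof. exact: sigma_algebra_bigcup. Qed.

(* The product sigma-algebra, i.e. the Borel one when T is the real line. *)
HB.instance Definition _ := @isMeasurable.Build (measure_rV_display d)
  'rV[T]_n (g_sigma_preimage coors) rV_set0 rV_setC rV_bigcup.

End measurable_rV.

Lemma measurable_coord_rV d (T : sigmaRingType d) n (i : 'I_n) :
  measurable_fun [set: 'rV[T]_n] (fun v : 'rV[T]_n => v ord0 i).
Proof.
move=> _ Y mY; rewrite setTI; apply: sub_sigma_algebra => /=.
rewrite -bigcup_seq/=; exists i => /=; first by rewrite mem_index_enum.
by exists Y => //; rewrite setTI.
Qed.

Lemma measurable_fun_rVP d1 d2 (T1 : measurableType d1) (T2 : measurableType d2)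
    n (f : T1 -> 'rV[T2]_n) :
  (forall i, measurable_fun [set: T1] (fun x => f x ord0 i)) ->
  measurable_fun [set: T1] f.
Proof.
move=> mf _ A mA; rewrite setTI.
have : g_sigma_preimage (fun i (v : 'rV[T2]_n) => v ord0 i) `<=`
       [set B | measurable (f @^-1` B)].
  apply: smallest_sub.
    split => [|B mB|F mF] /=.
    - by rewrite preimage_set0.
    - by rewrite setTD preimage_setC; exact: measurableC.
    - by rewrite preimage_bigcup; exact: bigcupT_measurable.
  rewrite -bigcup_seq => B [i _ [C mC <-]] /=.
  by rewrite setTI -comp_preimage -[X in measurable X]setTI; exact: mf.
exact.
Qed.

Lemma sigma_finite_product_measure1 d1 d2 (T1 : measurableType d1)
    (T2 : measurableType d2) (R : realType)
    (m1 : {sigma_finite_measure set T1 -> \bar R})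
    (m2 : {sigma_finite_measure set T2 -> \bar R}) :
  sigma_finite setT (m1 \x m2)%E.
Proof.
have /sigma_finiteP[F [TF ndF Foo]] := sigma_finiteT m1.
have /sigma_finiteP[G [TG ndG Goo]] := sigma_finiteT m2.
exists (fun n => F n `*` G n).
  rewrite -setXTT TF TG predeqE => -[x y]; split.
    move=> [/= [n _ Fnx] [k _ Gky]]; exists (maxn n k) => //; split.
    - by move: x Fnx; exact/subsetPset/ndF/leq_maxl.
    - by move: y Gky; exact/subsetPset/ndG/leq_maxr.
  by move=> [n _ []/= ? ?]; split; exists n.
move=> k; have [? ?] := Foo k; have [? ?] := Goo k.
split; first exact: measurableX.
by rewrite product_measure1E// lte_mul_pinfty// ge0_fin_numE.
Qed.

Section lebesgue_measure_rV.
Context {R : realType}.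

Definition rV_cons n (p : R * 'rV[R]_n) : 'rV[R]_n.+1 :=
  row_mx (const_mx p.1 : 'rV_1) p.2.

Definition rV_uncons n (v : 'rV[R]_n.+1) : R * 'rV[R]_n :=
  let v' : 'rV[R]_(1 + n) := v in (lsubmx v' ord0 ord0, rsubmx v').

Lemma rV_consK n : cancel (@rV_cons n) (@rV_uncons n).
Proof.
by case=> a v; rewrite /rV_uncons /rV_cons row_mxKl row_mxKr mxE.
Qed.

Lemma measurable_rV_cons n : measurable_fun setT (@rV_cons n).
Proof.
apply: measurable_fun_rVP => i.
rewrite (_ : (fun _ => _) = match @fintype.split 1 n i with
   | inl _ => fst | inr j => (fun v : 'rV[R]_n => v ord0 j) \o snd end).
  case: fintype.split => j; first exact: measurable_fst.
  by apply: measurableT_comp => //; exact: measurable_coord_rV.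
by apply/funext => p; rewrite /rV_cons mxE; case: fintype.split => j //; rewrite mxE.
Qed.

Lemma measurable_rV_uncons n : measurable_fun setT (@rV_uncons n).
Proof.
apply/measurable_fun_pairP; split.
  rewrite (_ : _ \o _ = fun v : 'rV[R]_(1 + n) => v ord0 (lshift n (ord0 : 'I_1))).
    exact: measurable_coord_rV.
  by apply/funext => v /=; rewrite mxE.
apply: measurable_fun_rVP => i.
rewrite (_ : (fun _ => _) =
    fun v : 'rV[R]_(1 + n) => v ord0 (rshift 1 i : 'I_(1 + n))).
  exact: measurable_coord_rV.
by apply/funext => v /=; rewrite mxE.
Qed.

Section step.
Local Open Scope ereal_scope.
Variables (n : nat) (m : {sigma_finite_measure set 'rV[R]_n -> \bar R}).

Definition lebesgue_rV_step : set 'rV[R]_n.+1 -> \bar R :=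
  pushforward (@lebesgue_measure R \x m) (@rV_cons n).

Let mcons (A : set 'rV[R]_n.+1) : measurable A ->
  measurable (@rV_cons n @^-1` A).
Proof.
by move=> mA; rewrite -[X in measurable X]setTI; exact: measurable_rV_cons.
Qed.

Let step0 : lebesgue_rV_step set0 = 0.
Proof. by rewrite /lebesgue_rV_step /pushforward preimage_set0 measure0. Qed.

Let step_ge0 A : 0 <= lebesgue_rV_step A.
Proof. by rewrite /lebesgue_rV_step /pushforward; exact: measure_ge0. Qed.

Let step_sigma_additive : semi_sigma_additive lebesgue_rV_step.
Proof.
move=> F mF tF mUF; rewrite /lebesgue_rV_step /pushforward preimage_bigcup.
apply: measure_semi_sigma_additive.
- by move=> i; exact: mcons.
- apply/trivIsetP => /= i j _ _ ij; rewrite -preimage_setI.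
  by move/trivIsetP : tF => /(_ _ _ _ _ ij) ->//; rewrite preimage_set0.
- by rewrite -preimage_bigcup; exact: mcons.
Qed.

HB.instance Definition _ := isMeasure.Build _ _ _
  lebesgue_rV_step step0 step_ge0 step_sigma_additive.

Let step_sigma_finite : sigma_finite setT lebesgue_rV_step.
Proof.
have [F TF Foo] := sigma_finite_product_measure1 (@lebesgue_measure R) m.
exists (fun k => @rV_uncons n @^-1` F k).
  by rewrite -preimage_bigcup -TF preimage_setT.
move=> k; have [mFk Fkoo] := Foo k; split.
  by rewrite -[X in measurable X]setTI; exact: measurable_rV_uncons.
rewrite /lebesgue_rV_step /pushforward -comp_preimage.
by rewrite (_ : _ \o _ = id) //; apply/funext => p /=; rewrite rV_consK.
Qed.

HB.instance Definition _ := @Measure_isSigmaFinite.Build _ _ _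
  lebesgue_rV_step step_sigma_finite.

End step.

(* d-dimensional Lebesgue measure (on Borel sets) as an iterated product of
   one-dimensional ones; it is the unit mass on the one-point space when
   d = 0. *)
Fixpoint lebesgue_measure_rV (n : nat) :
    {sigma_finite_measure set 'rV[R]_n -> \bar R} :=
  match n with
  | 0 => @dirac _ 'rV[R]_0 0 R
  | n'.+1 => lebesgue_rV_step (lebesgue_measure_rV n')
  end.

End lebesgue_measure_rV.

Section L2.
Context {R : realType} {d : nat}.
Implicit Types (Omega : set 'rV[R]_d) (f g : 'rV[R]_d -> R[i]).

Definition normsqC (z : R[i]) : R := complex.Re z ^+ 2 + complex.Im z ^+ 2.

Definition cintegral Omega f : R[i] :=
  Complex (\int[lebesgue_measure_rV d]_(x in Omega) complex.Re (f x))
          (\int[lebesgue_measure_rV d]_(x in Omega) complex.Im (f x)).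

Definition inner_prod Omega f g : R[i] :=
  cintegral Omega (fun x => f x * (g x)^*).

(* Extended-real valued: it is +oo when f is not square integrable. *)
Definition L2norm_sq Omega f : \bar R :=
  (\int[lebesgue_measure_rV d]_(x in Omega) (normsqC (f x))%:E)%E.

(* Elements of L^2(Omega) are handled through Borel representatives. *)
Definition in_L2 Omega f : Prop :=
  [/\ measurable_fun Omega (fun x => complex.Re (f x)),
      measurable_fun Omega (fun x => complex.Im (f x)) &
      (L2norm_sq Omega f < +oo)%E].

Definition orthonormal_system Omega (E : set ('rV[R]_d -> R[i])) : Prop :=
  [/\ forall u, E u -> in_L2 Omega u,
      forall u, E u -> inner_prod Omega u u = 1 &
      forall u v, E u -> E v -> u <> v -> inner_prod Omega u v = 0].

(* The linear span of E is dense in L^2(Omega). *)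
Definition total_system Omega (E : set ('rV[R]_d -> R[i])) : Prop :=
  forall f, in_L2 Omega f -> forall eps : R, 0 < eps ->
  exists (n : nat) (u : 'I_n -> 'rV[R]_d -> R[i]) (c : 'I_n -> R[i]),
    (forall k, E (u k)) /\
    (L2norm_sq Omega (fun x => f x - \sum_(k < n) c k * u k x)%R
      < (eps ^+ 2)%:E)%E.

Definition orthonormal_basis Omega (E : set ('rV[R]_d -> R[i])) : Prop :=
  orthonormal_system Omega E /\ total_system Omega E.

End L2.

Section spectral.
Context {R : realType} {d : nat}.
Implicit Types (Omega Lambda : set 'rV[R]_d) (x lambda : 'rV[R]_d).

Definition dotv lambda x : R := \sum_(i < d) lambda ord0 i * x ord0 i.

(* exp(i theta), by Euler's formula. *)
Definition expi (theta : R) : R[i] := Complex (cos theta) (sin theta).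

Definition e_ lambda : 'rV[R]_d -> R[i] :=
  fun x => expi (2 * pi * dotv lambda x).

(* The requirement that Omega be measurable of measure 1 is left to the
   context in which the predicate is used. *)
Definition spectral Omega : Prop :=
  exists Lambda, Lambda `<=` isolated Lambda /\
    orthonormal_basis Omega [set e_ lambda | lambda in Lambda].

Definition symmetric_wrt Omega (x0 : 'rV[R]_d) : Prop :=
  forall y, Omega y -> Omega (2 *: x0 - y).

Definition non_symmetric Omega : Prop := forall x0, ~ symmetric_wrt Omega x0.

End spectral.

(* Main.v *)
(** Let [K = (Omega - Omega) / 2].  Cut [K] (or a set slightly inside it) into small pieces [Q_i].
    If [c_i = (p_i - q_i) / 2] lies in [Q_i], with [p_i, q_i] in [Omega], then the single vector
    [(q_i + q_j) / 2] moves both [Q_i] and [Q_j] into [Omega], so the Fourier coefficients of the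
    two indicator functions can be compared inside [L^2(Omega)].  By polarization, Bessel's
    inequality (for sums) and completeness (for differences) yield
    [sum_lambda a_i(lambda) * conj (a_j(lambda)) <= delta_ij |Q_i|], and summing over [i, j] gives
    [sum_lambda |hat 1_K (lambda - lambda_0)|^2 <= |K|]; the term [lambda = lambda_0] alone is
    [|K|^2], hence [|K| <= 1 = |Omega|].

    This is the equality case of the Brunn-Minkowski inequality for [Omega] and [- Omega], which
    forces symmetry.  Let [f] and [k] be the section volumes of [Omega] and [K] along some
    direction.  Since [k ((s - t) / 2) ^ 2 >= f s * f t] and [k] has no larger integral than [f],
    the superlevel intervals [{f > r} = ]a_r, b_r[] satisfy
    [b_s - a_t <= b_r - a_r] whenever [r ^ 2 = s * t].  So the midpoints of these intervals vary
    by at most the second difference of their lengths in [ln r], which telescopes to [0]: all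
    midpoints coincide and [f] is symmetric.  Its center is the projection of the centroid of
    [Omega]; letting the direction vary and separating points from [Omega] by hyperplanes, one
    finds that [Omega] is symmetric about its centroid. *)

Require Import Defs.
From mathcomp Require Import all_boot all_order all_algebra.
From mathcomp Require Import complex ring lra.
From mathcomp Require Import all_classical all_reals all_analysis.
From mathcomp Require Import measurable_realfun.

Set Implicit Arguments.
Unset Strict Implicit.
Unset Printing Implicit Defensive.

Import Order.TTheory GRing.Theory Num.Theory.
Import numFieldNormedType.Exports.

Local Open Scope classical_set_scope.
Local Open Scope ring_scope.

(** * Lebesgue measure under affine maps and shears *)

Section lebesgue_affine.
Context {R : realType}.
Local Notation leb := (@lebesgue_measure R).

Lemma measurable_affine (r b : R) : measurable_fun [set: R] (fun x : R => r * x + b).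
Proof. by apply: measurable_funD => //; exact: measurable_funM. Qed.

(** By uniqueness of Lebesgue measure it suffices to compare both sides on the intervals []a, c]].
    For [r < 0] the preimage contains its left end instead of its right one, which does not change
    its length. *)
Lemma lebesgue_measure_affine (r b : R) (A : set R) : r != 0 -> measurable A ->
  (leb A = `|r|%:E * leb [set x | A (r * x + b)%R])%E.
Proof.
move=> r0 mA.
pose phi : measurableTypeR R -> measurableTypeR R := fun x => r * x + b.
have mphi : measurable_fun setT phi by exact: measurable_affine.
pose mu0 : {measure set (measurableTypeR R) -> \bar R} := pushforward leb phi.
pose mu := mu0 mphi.
pose nu := mscale (NngNum (normr_ge0 r)) mu.
rewrite (@lebesgue_measure_unique R nu) //= => X [[a c] _ <- /=].
rewrite /nu /mscale /= /mu /mu0 /= /pushforward /= /phi /=.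
rewrite lebesgue_measure_itv /= lte_fin.
have [r1|r1|r1] := ltgtP r 0; last by rewrite r1 eqxx in r0.
- rewrite (_ : _ @^-1` _ = `[(c - b) / r, (a - b) / r[%classic); last first.
    apply/seteqP; split => x /=; rewrite !in_itv /=.
      rewrite ler_ndivrMr // ltr_ndivlMr // (mulrC x); lra.
    rewrite ler_ndivrMr // ltr_ndivlMr // (mulrC x); lra.
  rewrite lebesgue_measure_itv /= lte_fin ltr_nM2r ?invr_lt0 //.
  rewrite ltrD2r; case: ifPn => ac; last by rewrite mule0.
  by rewrite -!EFinD -EFinM ltr0_norm //; congr EFin; field.
- rewrite (_ : _ @^-1` _ = `](a - b) / r, (c - b) / r]%classic); last first.
    apply/seteqP; split => x /=; rewrite !in_itv /=.
      rewrite ler_pdivlMr // ltr_pdivrMr // (mulrC x); lra.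
    rewrite ler_pdivlMr // ltr_pdivrMr // (mulrC x); lra.
  rewrite lebesgue_measure_itv /= lte_fin ltr_pM2r ?invr_gt0 //.
  rewrite ltrD2r; case: ifPn => ac; last by rewrite mule0.
  by rewrite -!EFinD -EFinM gtr0_norm //; congr EFin; field.
Qed.

Lemma integral_affine (r b : R) (f : R -> \bar R) : r != 0 ->
  measurable_fun setT f -> (forall x, 0 <= f x)%E ->
  (\int[leb]_x f x = `|r|%:E * \int[leb]_x f (r * x + b)%R)%E.
Proof.
move=> r0 mf f0.
pose phi : measurableTypeR R -> measurableTypeR R := fun x => r * x + b.
have mphi : measurable_fun setT phi by exact: measurable_affine.
pose mu0 : {measure set (measurableTypeR R) -> \bar R} := pushforward leb phi.
pose mu := mu0 mphi.
rewrite -(@ge0_integral_pushforward _ _ _ _ R phi mphi leb setT) //.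
rewrite -[in RHS](ge0_integral_mscale mu measurableT (NngNum (normr_ge0 r))) //.
by apply: eq_measure_integral => A mA _; exact: lebesgue_measure_affine.
Qed.

End lebesgue_affine.

Section vol.
Context {R : realType}.
Local Notation leb := (@lebesgue_measure R).
Local Notation vol := (@lebesgue_measure_rV R _).

Definition sec n (A : set 'rV[R]_n.+1) (t : R) : set 'rV[R]_n :=
  [set y | A (rV_cons (t, y))].

Lemma rV_unconsK n : cancel (@rV_uncons R n) (@rV_cons R n).
Proof. by move=> v; apply/rowP => i; rewrite /rV_cons /rV_uncons /=
  -[in RHS](hsubmxK (v : 'rV_(1 + n))); congr (row_mx _ _ _ _);
  apply/matrixP => j k; rewrite !mxE !ord1. Qed.

Lemma rV_cons_fst n t (y : 'rV[R]_n) : rV_cons (t, y) ord0 ord0 = t.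
Proof. by rewrite /rV_cons mxE; case: splitP => // j _; rewrite mxE. Qed.

Lemma rV_cons_snd n t (y : 'rV[R]_n) i : rV_cons (t, y) ord0 (lift ord0 i) = y ord0 i.
Proof.
rewrite /rV_cons mxE; case: splitP => [j|j]; first by rewrite ord1.
by move=> [] /esym /val_inj ->.
Qed.

Lemma rV_consP n (v : 'rV[R]_n.+1) : exists t y, v = rV_cons (t, y).
Proof. by exists (rV_uncons v).1, (rV_uncons v).2; rewrite -surjective_pairing rV_unconsK. Qed.

Lemma rV_cons_lin n (a b s t : R) (x y : 'rV[R]_n) :
  a *: rV_cons (s, x) + b *: rV_cons (t, y) = rV_cons (a * s + b * t, a *: x + b *: y).
Proof.
apply/rowP => i; rewrite !mxE.
by case: (fintype.split) => j; rewrite !mxE.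
Qed.

Lemma rV_consD n (s t : R) (x y : 'rV[R]_n) :
  rV_cons (s, x) + rV_cons (t, y) = rV_cons (s + t, x + y).
Proof. by have := rV_cons_lin 1 1 s t x y; rewrite !scale1r !mul1r. Qed.

Lemma rV_consZ n a (s : R) (x : 'rV[R]_n) :
  a *: rV_cons (s, x) = rV_cons (a * s, a *: x).
Proof. by have := rV_cons_lin a 0 s 0 x 0; rewrite !scale0r !mul0r !addr0. Qed.

Lemma rV_consN n (s : R) (x : 'rV[R]_n) : - rV_cons (s, x) = rV_cons (- s, - x).
Proof. by rewrite -scaleN1r rV_consZ mulN1r scaleN1r. Qed.

Lemma measurable_preimage_rV_cons n (A : set 'rV[R]_n.+1) : measurable A ->
  measurable (@rV_cons R n @^-1` A).
Proof. by move=> mA; rewrite -[X in measurable X]setTI; exact: measurable_rV_cons. Qed.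

Lemma sec_xsection n (A : set 'rV[R]_n.+1) t :
  sec A t = xsection (@rV_cons R n @^-1` A) t.
Proof. by apply/seteqP; split => y; rewrite /xsection /= inE. Qed.

Lemma measurable_sec n (A : set 'rV[R]_n.+1) t : measurable A -> measurable (sec A t).
Proof.
move=> mA; rewrite sec_xsection; apply: measurable_xsection.
exact: measurable_preimage_rV_cons.
Qed.

Lemma measurable_fun_sec n (A : set 'rV[R]_n.+1) : measurable A ->
  measurable_fun [set: R] (fun t => vol (sec A t)).
Proof.
move=> mA; under eq_fun do rewrite sec_xsection.
exact: (measurable_fun_xsection (@lebesgue_measure_rV R n) (measurable_preimage_rV_cons mA)).
Qed.

Lemma volS n (A : set 'rV[R]_n.+1) :
  vol A = (\int[leb]_t vol (sec A t))%E.
Proof.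
rewrite /= /lebesgue_rV_step /pushforward /= /product_measure1.
by apply: eq_integral => t _ /=; rewrite sec_xsection.
Qed.

(** Tonelli, integrating over the first coordinate innermost. This is the order suited to shears,
    which translate every line in the first direction. *)
Lemma volS' n (A : set 'rV[R]_n.+1) : measurable A ->
  vol A = (\int[lebesgue_measure_rV n]_y leb [set t | A (rV_cons (t, y))])%E.
Proof.
move=> mA; have mA' := measurable_preimage_rV_cons mA.
rewrite /= /lebesgue_rV_step /pushforward.
rewrite (@product_measure_unique _ _ _ _ _ leb (lebesgue_measure_rV n)
  (product_measure2 leb (lebesgue_measure_rV n))) //; last first.
  by move=> B C mB mC; exact: product_measure2E.
apply: eq_integral => y _ /=; congr (leb _).
by apply/seteqP; split => t; rewrite /ysection /= inE.
Qed.

Lemma measurable_rV_affine n (a : R) (v : 'rV[R]_n) :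
  measurable_fun setT (fun x : 'rV[R]_n => a *: x + v).
Proof.
apply: measurable_fun_rVP => i; under eq_fun do rewrite !mxE.
by apply: measurable_funD => //; apply: measurable_funM => //; exact: measurable_coord_rV.
Qed.

Lemma measurable_preimage d1 d2 (T1 : measurableType d1) (T2 : measurableType d2)
  (f : T1 -> T2) (A : set T2) : measurable_fun setT f -> measurable A ->
  measurable (f @^-1` A).
Proof. by move=> mf mA; rewrite -[X in measurable X]setTI; exact: mf. Qed.

(** Induction on the dimension, one section at a time. The cases of interest are translations
    ([a = 1]) and the point reflection ([a = -1]). *)
Lemma vol_affine n (a : R) (v : 'rV[R]_n) (A : set 'rV[R]_n) : `|a| = 1 -> measurable A ->
  vol [set x | A (a *: x + v)] = vol A.
Proof.
move=> a1; elim: n => [|n IH] in v A * => mA.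
  rewrite (_ : [set x | _] = A) //; apply/seteqP.
  by split=> x /=; rewrite (thinmx0 x) (thinmx0 (_ + _)).
have [s [w ->]] := rV_consP v.
rewrite !volS.
rewrite [RHS](@integral_affine _ a s) //; last 2 first.
- by rewrite -normr_eq0 a1 oner_eq0.
- exact: measurable_fun_sec.
rewrite a1 mul1e; apply: eq_integral => t _.
rewrite -(IH w _ (measurable_sec (a * t + s) mA)).
by congr (vol _); apply/seteqP; split => y; rewrite /sec /= rV_consZ rV_consD.
Qed.

(** A transvection; the first coordinate of the image is the value of the functional
    [rV_cons (1, c)]. It reduces statements about such a functional to the first coordinate. *)
Definition shear n (c : 'rV[R]_n) (x : 'rV[R]_n.+1) : 'rV[R]_n.+1 :=
  rV_cons ((rV_uncons x).1 + dotv c (rV_uncons x).2, (rV_uncons x).2).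

Lemma measurable_dotv n (c : 'rV[R]_n) : measurable_fun setT (dotv c).
Proof.
apply: measurable_sum => i; apply: measurable_funM => //.
exact: measurable_coord_rV.
Qed.

Lemma measurable_shear n (c : 'rV[R]_n) : measurable_fun setT (shear c).
Proof.
have /measurable_fun_pairP[m1 m2] := @measurable_rV_uncons R n.
apply: measurableT_comp; first exact: measurable_rV_cons.
apply/measurable_fun_pairP; split; last exact: m2.
apply: measurable_funD; first exact: m1.
exact: measurableT_comp (measurable_dotv c) m2.
Qed.

(** On the line of points [rV_cons (t, y)] with [y] fixed, the shear is the translation by
    [dotv c y]. *)
Lemma vol_shear n (c : 'rV[R]_n) (A : set 'rV[R]_n.+1) : measurable A ->
  vol (shear c @^-1` A) = vol A.
Proof.
move=> mA; rewrite !volS' //; last first.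
  exact: measurable_preimage (measurable_shear c) mA.
apply: eq_integral => y _.
have my : measurable [set t | A (rV_cons (t, y))].
  have := @measurable_ysection _ _ R _ _ y (measurable_preimage_rV_cons mA).
  congr (measurable _).
  by apply/seteqP; split => t; rewrite /ysection /= inE.
rewrite [RHS](@lebesgue_measure_affine _ 1 (dotv c y)) ?oner_neq0 //.
rewrite normr1 mul1e; congr (leb _).
by apply/seteqP; split => t /=; rewrite /shear rV_consK mul1r.
Qed.

End vol.

(** * Topology and measure of row vectors *)

Section vol_topology.
Context {R : realType}.
Local Notation leb := (@lebesgue_measure R).
Local Notation vol := (@lebesgue_measure_rV R _).

Definition cube n (v : 'rV[R]_n) (e : R) : set 'rV[R]_n :=
  [set w | forall i, `|w ord0 i - v ord0 i| < e].

Lemma cube_nbhs n (v : 'rV[R]_n) e : 0 < e -> nbhs v (cube v e).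
Proof.
move=> e0; apply/nbhs_ballP; exists e => //= w [_ vw] i.
by rewrite distrC; exact: vw.
Qed.

Lemma open_cubeP n (A : set 'rV[R]_n) :
  open A <-> forall v, A v -> exists2 e : R, 0 < e & cube v e `<=` A.
Proof.
split=> [oA v Av|h].
  have /nbhs_ballP[e /= e0 eA] : nbhs v A by exact: open_nbhs_nbhs.
  exists e => // w vw; apply: eA; split => // i j.
  by rewrite !ord1 /ball /= distrC; exact: vw.
rewrite openE => v Av; have [e e0 eA] := h v Av.
exact: filterS eA (cube_nbhs v e0).
Qed.

Lemma coord_le_norm n (v : 'rV[R]_n) i : `|v ord0 i| <= `|v|.
Proof.
have -> : `|v| = mx_norm v by [].
rewrite mx_normrE.
by apply: (@le_bigmax_cond _ _ _ _ (ord0, i) xpredT (fun ij => `|v ij.1 ij.2|)).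
Qed.

Lemma bounded_coordP n (A : set 'rV[R]_n) : bounded_set A ->
  exists2 M : R, 0 < M & forall v, A v -> forall i, `|v ord0 i| <= M.
Proof.
move=> [M [Mreal h]]; exists (`|M| + 1); first by rewrite ltr_wpDl.
move=> v Av i; apply: le_trans (coord_le_norm v i) _.
by apply: (h (`|M| + 1)) => //; rewrite (le_lt_trans (ler_norm M)) // ltrDl.
Qed.

Lemma measurable_cube n (v : 'rV[R]_n) e : measurable (cube v e).
Proof.
have -> : cube v e = \bigcap_(i in [set: 'I_n])
    ((fun w : 'rV[R]_n => w ord0 i) @^-1` ball (v ord0 i) e).
  by apply/seteqP; split => [w vw i _|w vw i]; have := vw i; rewrite /ball /= distrC //; exact.
apply: fin_bigcap_measurable => [|i _]; first exact: finite_finset.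
apply: measurable_preimage; first exact: measurable_coord_rV.
exact: measurable_ball.
Qed.

(** The sigma-algebra is the product one, so an open set is exhibited as the countable union of the
    cubes with rational center and radius [k.+1%:R^-1] that it contains. *)
Lemma open_measurable_rV n (A : set 'rV[R]_n) : open A -> measurable A.
Proof.
move=> oA; pose P (x : 'rV[rat]_n * nat) := cube (map_mx ratr x.1) x.2.+1%:R^-1 `<=` A.
rewrite (_ : A = \bigcup_(x in [set: 'rV[rat]_n * nat])
    (if `[< P x >] then cube (map_mx ratr x.1) x.2.+1%:R^-1 else set0)); last first.
  apply/seteqP; split => [v Av|v [x _]]; last first.
    by case: ifP => // /asboolP; exact.
  have /open_cubeP/(_ v Av)[e e0 eA] := oA.
  have [k ke] : exists k : nat, k.+1%:R^-1 < e / 2.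
    have e20 : 0 < e / 2 by rewrite divr_gt0.
    by have [k _ /(_ k (leqnn k))] := near_infty_natSinv_lt (PosNum e20); exists k.
  (* The cube of radius [k.+1%:R^-1 < e / 2] about such a rational point contains [v] and stays
     within the cube of radius [e] about [v]. *)
  have /choice[q qP] : forall i, exists q : rat, ratr q \in `](v ord0 i - k.+1%:R^-1), v ord0 i[.
    by move=> i; apply: rat_in_itvoo; rewrite ltrBlDr ltrDl invr_gt0.
  have near i : `|v ord0 i - ratr (q i)| < k.+1%:R^-1.
    by have := qP i; rewrite in_itv /= => /andP[h1 h2]; rewrite gtr0_norm ?subr_gt0 //
      ltrBlDr -ltrBlDl.
  exists (\row_i q i, k) => //; rewrite ifT; last first.
    apply/asboolP => w /= hw; apply: eA => i.
    have := hw i; rewrite !mxE => {}hw.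
    rewrite (le_lt_trans (ler_distD (ratr (q i)) _ _)) //.
    have := near i; rewrite (distrC (v _ _)); move: hw ke; set d := _^-1; lra.
  by move=> i /=; rewrite !mxE; exact: near.
apply: countable_bigcupT_measurable => [|x]; first exact: countableP.
by case: ifP => // _; exact: measurable_cube.
Qed.

Lemma open_sec n (A : set 'rV[R]_n.+1) t : open A -> open (sec A t).
Proof.
move=> /open_cubeP oA; apply/open_cubeP => y /oA[e e0 eA].
exists e => // z yz; apply: eA => i.
case: (unliftP ord0 i) => [j ->|->]; first by rewrite !rV_cons_snd.
by rewrite !rV_cons_fst subrr normr0.
Qed.

Definition bounded_by n (M : R) (A : set 'rV[R]_n) :=
  forall v, A v -> forall i, `|v ord0 i| <= M.

Lemma bounded_by_sec n M (A : set 'rV[R]_n.+1) t : bounded_by M A -> bounded_by M (sec A t).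
Proof. by move=> AM y /AM + i => /(_ (lift ord0 i)); rewrite rV_cons_snd. Qed.

Lemma sec_out n M (A : set 'rV[R]_n.+1) t : bounded_by M A -> M < `|t| -> sec A t = set0.
Proof.
move=> AM Mt; apply/seteqP; split => // y /AM /(_ ord0).
by rewrite rV_cons_fst => /(lt_le_trans Mt); rewrite ltxx.
Qed.

(** The bound depends on [n] and [M] only, so it applies to all sections of a bounded set at once
    and makes the supremum of their volumes finite. *)
Lemma vol_bounded_by n (M : R) : 0 < M -> exists2 V : R, 0 < V &
  forall A : set 'rV[R]_n, measurable A -> bounded_by M A -> (vol A <= V%:E)%E.
Proof.
move=> M0; elim: n => [|n [V V0 IH]].
  by exists 1 => // A mA _; rewrite /= diracE; case: (_ \in _); rewrite lee_fin.
exists (V * (M *+ 2)); first by rewrite mulr_gt0 // mulrn_wgt0.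
move=> A mA AM; rewrite volS.
have -> : (\int[leb]_t vol (sec A t) = \int[leb]_(t in `[(- M)%R, M]) vol (sec A t))%E.
  rewrite [RHS]integral_mkcond; apply: eq_integral => t _; rewrite patchE.
  case: ifPn => //; rewrite notin_setE /= in_itv /= -ler_norml => /negP.
  by rewrite -ltNge => /(sec_out AM) ->; rewrite measure0.
have -> : (V * (M *+ 2))%:E = (\int[leb]_(t in `[(- M)%R, M]) V%:E)%E.
  rewrite integral_cst //= lebesgue_measure_itv /= lte_fin gtrN //.
  by rewrite -EFinD -EFinM opprK -mulr2n.
apply: ge0_le_integral => //.
- by apply: measurable_funTS; exact: measurable_fun_sec.
- by move=> t _; apply: IH; [exact: measurable_sec|exact: bounded_by_sec].
Qed.

Lemma vol_bounded_lty n M (A : set 'rV[R]_n) : 0 < M -> measurable A -> bounded_by M A ->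
  (vol A < +oo)%E.
Proof.
by move=> M0 mA AM; have [V _ /(_ _ mA AM)/le_lt_trans -> //] := vol_bounded_by n M0;
  rewrite ltry.
Qed.

Lemma vol_cube_gt0 n (v : 'rV[R]_n) e : 0 < e -> (0 < vol (cube v e))%E.
Proof.
move=> e0; elim: n => [|n IH] in v *.
  by rewrite /= diracE mem_set //= => -[].
have [t [y ->]] := rV_consP v; rewrite volS.
have -> : (\int[leb]_s vol (sec (cube (rV_cons (t, y)) e) s) =
    \int[leb]_(s in `](t - e)%R, (t + e)%R[) vol (cube y e))%E.
  rewrite [RHS]integral_mkcond; apply: eq_integral => s _; rewrite patchE.
  case: ifPn; rewrite ?notin_setE ?inE /= in_itv /= -ltr_distl => st.
    congr (vol _); apply/seteqP; split => z zc i.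
      by have := zc (lift ord0 i); rewrite !rV_cons_snd.
    by case: (unliftP ord0 i) => [j ->|->]; rewrite ?rV_cons_snd ?rV_cons_fst.
  rewrite (_ : sec _ _ = set0) ?measure0 //; apply/seteqP; split => // z /(_ ord0).
  by rewrite !rV_cons_fst.
rewrite integral_cst //= lebesgue_measure_itv /= lte_fin ltrD2l gtrN // mule_gt0 //.
by rewrite -EFinD lte_fin; lra.
Qed.

Lemma open_vol_gt0 n (A : set 'rV[R]_n) v : open A -> A v -> (0 < vol A)%E.
Proof.
move=> oA Av; have /open_cubeP/(_ v Av)[e e0 eA] := oA.
apply: lt_le_trans (vol_cube_gt0 v e0) _; apply: le_measure => //; rewrite inE.
  exact: measurable_cube.
exact: open_measurable_rV.
Qed.

End vol_topology.

(** * Layer cake and the one-dimensional inequality *)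

Section prekopa_leindler.
Context {R : realType}.
Local Notation leb := (@lebesgue_measure R).

(** The part cut off lies in []a, s]]. This allows [A] to be replaced by its part below one of its
    own points close to the supremum. *)
Lemma lebesgue_measure_truncr (A : set R) (s a : R) : measurable A -> a <= s ->
  (forall x, A x -> x <= s) ->
  (leb A <= leb (A `&` `]-oo, a]) + (s - a)%:E)%E.
Proof.
move=> mA le_as As.
have -> : (s - a)%:E = leb `]a, s].
  rewrite lebesgue_measure_itv /= lte_fin; case: ltP => // sa.
  by rewrite (le_anti (introT andP (conj le_as sa))) subrr.
apply: (@le_trans _ _ (leb ((A `&` `]-oo, a]) `|` `]a, s]))); last first.
  by apply: measureU2 => //; exact: measurableI.
apply: le_measure; rewrite ?inE //.
  by apply: measurableU => //; exact: measurableI.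
move=> x Ax; case: (leP x a) => xa; [left|right]; rewrite /= ?in_itv //=.
by rewrite xa As.
Qed.

Lemma lebesgue_measure_truncl (A : set R) (s a : R) : measurable A -> s <= a ->
  (forall x, A x -> s <= x) ->
  (leb A <= leb (A `&` `]a, +oo[) + (a - s)%:E)%E.
Proof.
move=> mA le_as As.
have -> : (a - s)%:E = leb `[s, a].
  rewrite lebesgue_measure_itv /= lte_fin; case: ltP => // sa.
  by rewrite (le_anti (introT andP (conj le_as sa))) subrr.
apply: (@le_trans _ _ (leb ((A `&` `]a, +oo[) `|` `[s, a]))); last first.
  by apply: measureU2 => //; exact: measurableI.
apply: le_measure; rewrite ?inE //.
  by apply: measurableU => //; exact: measurableI.
move=> x Ax; case: (leP x a) => xa; [right|left]; rewrite /= ?in_itv //=.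
  by rewrite xa As.
by rewrite xa.
Qed.

(** Choose [a] in [A] close to [sup A] and [b] in [B] close to [inf B]. The translates of [A] below
    [a] by [b], and of [B] above [b] by [a], lie on opposite sides of [a + b], hence are disjoint,
    and both are contained in the dilate [C2] of [C] by 2. *)
Lemma lebesgue_measure_midpoint (A B C : set R) :
  measurable A -> measurable B -> measurable C -> has_sup A -> has_inf B ->
  (forall a b, A a -> B b -> C ((a + b) / 2)) ->
  (leb A + leb B <= 2%:E * leb C)%E.
Proof.
move=> mA mB mC sA iB ABC; apply/lee_addgt0Pr => e e0.
have e20 : 0 < e / 2 by rewrite divr_gt0.
have [a Aa ha] := sup_adherent e20 sA.
have [b Bb hb] := inf_adherent e20 iB.
pose C2 := [set c | C (2^-1 * c + 0)].
have mC2 : measurable C2 by apply: measurable_preimage mC; exact: measurable_affine.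
have -> : (2%:E * leb C = leb C2)%E.
  rewrite (@lebesgue_measure_affine _ 2^-1 0 C) ?invr_eq0 // muleA -EFinM.
  by rewrite ger0_norm ?invr_ge0 // divff ?mul1e.
have mA1 : measurable (A `&` `]-oo, a]) by exact: measurableI.
have mB1 : measurable (B `&` `]b, +oo[) by exact: measurableI.
have sum : (leb (A `&` `]-oo, a]) + leb (B `&` `]b, +oo[) <= leb C2)%E.
  rewrite (@lebesgue_measure_affine _ 1 (- b) (A `&` _)) ?oner_eq0 //.
  rewrite (@lebesgue_measure_affine _ 1 (- a) (B `&` _)) ?oner_eq0 //.
  rewrite normr1 !mul1e -measureU; first apply: le_measure; rewrite ?inE //.
  - by apply: measurableU; apply: measurable_preimage => //; exact: measurable_affine.
  - move=> x [[h _]|[h _]]; rewrite /C2 /=.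
      by have := ABC _ _ h Bb; congr C; field.
    by have := ABC _ _ Aa h; congr C; field.
  - by apply: measurable_preimage => //; exact: measurable_affine.
  - by apply: measurable_preimage => //; exact: measurable_affine.
  - apply/seteqP; split => // x [[_]] /=; rewrite in_itv /= => h1 [_].
    by rewrite in_itv /= andbT => h2; lra.
have hA : (leb A <= leb (A `&` `]-oo, a]) + (e / 2)%:E)%E.
  apply: le_trans (@lebesgue_measure_truncr A (sup A) a mA _ _) _.
  - by apply: ub_le_sup => //; case: sA.
  - by move=> x Ax; apply: ub_le_sup => //; case: sA.
  - by rewrite leeD2l // lee_fin; lra.
have hB : (leb B <= leb (B `&` `]b, +oo[) + (e / 2)%:E)%E.
  apply: le_trans (@lebesgue_measure_truncl B (inf B) b mB _ _) _.
  - by apply: ge_inf => //; case: iB.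
  - by move=> x Bx; apply: ge_inf => //; case: iB.
  - by rewrite leeD2l // lee_fin; lra.
apply: le_trans (leeD hA hB) _; rewrite addeACA.
by rewrite -EFinD -splitr leeD2r.
Qed.

Section layer_cake.
Variables (f : R -> R) (mf : measurable_fun setT f).

Let S : set (measurableTypeR R * measurableTypeR R) := [set p | 0 < p.2 /\ p.2 < f p.1].

Let mS : measurable S.
Proof.
have -> : S = ((fun p => 0 < p.2) @^-1` [set true]) `&`
    ((fun p => p.2 < f p.1) @^-1` [set true]) by apply/seteqP; split => p.
by apply: measurableI; apply: measurable_preimage => //;
  apply: measurable_fun_ltr => //; exact: measurableT_comp.
Qed.

Lemma measurable_superlevel r : measurable [set t | r < f t].
Proof.
have -> : [set t | r < f t] = f @^-1` `]r, +oo[.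
  by apply/seteqP; split => x /=; rewrite in_itv /= andbT.
exact: measurable_preimage.
Qed.

Lemma measurable_fun_superlevel :
  measurable_fun (`]0, +oo[%classic : set R) (fun r : R => leb [set t | r < f t]).
Proof.
apply: (eq_measurable_fun (leb \o ysection S)) => [r /[!inE] /=|]; last first.
  by apply: measurable_funTS; exact: measurable_fun_ysection.
rewrite in_itv /= andbT => r0; congr (leb _).
by apply/seteqP; split => t; rewrite /ysection /= inE /S /=; [case|].
Qed.

(** Both sides are the area of the region [S] under the graph, sliced in the two directions. *)
Lemma layer_cake : (forall t, 0 <= f t) ->
  (\int[leb]_t (f t)%:E = \int[leb]_(r in `]0%R, +oo[) leb [set t | (r < f t)%R])%E.
Proof.
move=> f0.
transitivity ((leb \x leb)%E S).
  rewrite /= /product_measure1; apply: eq_integral => t _ /=.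
  rewrite (_ : xsection S t = `]0, (f t)[%classic).
    rewrite lebesgue_measure_itv /= lte_fin; case: ltP => [_|]; first by rewrite oppr0 adde0.
    by move=> h; congr EFin; apply: le_anti; rewrite h f0.
  by apply/seteqP; split => r; rewrite /xsection /= inE /S /= in_itv /= => /andP.
rewrite (@product_measure_unique _ _ _ _ _ leb leb (product_measure2 leb leb)) //; last first.
  by move=> B C mB mC; exact: product_measure2E.
rewrite /= /product_measure2 [RHS]integral_mkcond; apply: eq_integral => r _ /=.
rewrite patchE; case: ifPn; rewrite ?notin_setE ?inE /= in_itv /= andbT => r0.
  by congr (leb _); apply/seteqP; split => t; rewrite /ysection /= inE /S /=; [case|].
rewrite -[RHS](measure0 leb); congr (leb _); apply/seteqP; split => t //.
by rewrite /ysection /= inE /S /= => -[/r0].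
Qed.

End layer_cake.

(** Layer cake, with [lebesgue_measure_midpoint] at every level. The common normalization of [f] and
    [g] matters: at levels below 1 both superlevel sets are nonempty, and from 1 on both are
    empty. *)
Lemma integral_midpoint_le (f g k : R -> R) :
  measurable_fun setT f -> measurable_fun setT g -> measurable_fun setT k ->
  (forall t, 0 <= f t <= 1) -> (forall t, 0 <= g t <= 1) -> (forall t, 0 <= k t) ->
  (forall r, 0 < r < 1 -> has_sup [set t | r < f t] /\ has_inf [set t | r < g t]) ->
  (forall r s t, 0 < r -> r < f s -> r < g t -> r < k ((s + t) / 2)) ->
  (\int[leb]_t (f t)%:E + \int[leb]_t (g t)%:E <= 2%:E * \int[leb]_t (k t)%:E)%E.
Proof.
move=> mf mg mk f01 g01 k0 fg fgk.
have f0 t : 0 <= f t by have /andP[] := f01 t.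
have g0 t : 0 <= g t by have /andP[] := g01 t.
rewrite !layer_cake // -ge0_integralD //; last 2 first.
- exact: measurable_fun_superlevel.
- exact: measurable_fun_superlevel.
rewrite -ge0_integralZl //; last exact: measurable_fun_superlevel.
apply: ge0_le_integral => //.
- by move=> r _; rewrite adde_ge0.
- by apply: emeasurable_funD; exact: measurable_fun_superlevel.
- by apply: measurable_funeM; exact: measurable_fun_superlevel.
move=> r; rewrite /= in_itv /= andbT => r0.
have [r1|r1] := ltP r 1; last first.
  have E (h : R -> R) : (forall t, 0 <= h t <= 1) -> [set t | r < h t] = set0.
    move=> h1; apply/seteqP; split => // t /= rt.
    by have /andP[_ /(lt_le_trans rt)] := h1 t; rewrite ltNge r1.
  by rewrite (E f) // (E g) // measure0 adde0 mule_ge0.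
have [hf hg] := fg r (introT andP (conj r0 r1)).
apply: lebesgue_measure_midpoint => //; try exact: measurable_superlevel.
by move=> a b /= ra rb; exact: fgk.
Qed.

End prekopa_leindler.

(** * The Brunn-Minkowski inequality *)

Section brunn_minkowski.
Context {R : realType}.
Local Notation leb := (@lebesgue_measure R).
Local Notation vol := (@lebesgue_measure_rV R _).

Definition rvol n (A : set 'rV[R]_n) : R := fine (lebesgue_measure_rV n A).

Lemma rvol_ge0 n (A : set 'rV[R]_n) : 0 <= rvol A.
Proof. exact/fine_ge0/measure_ge0. Qed.

Lemma rvol0 n : rvol (set0 : set 'rV[R]_n) = 0.
Proof. by rewrite /rvol measure0. Qed.

Lemma rvol_dim0 (A : set 'rV[R]_0) : rvol A = (0 \in A)%:R.
Proof. by rewrite -[RHS]/(fine (_%:E)) -diracE. Qed.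

Lemma rvolK n M (A : set 'rV[R]_n) : 0 < M -> measurable A -> bounded_by M A ->
  (rvol A)%:E = vol A.
Proof.
move=> M0 mA AM; rewrite /rvol fineK // ge0_fin_numE ?measure_ge0 //.
exact: vol_bounded_lty M0 mA AM.
Qed.

Lemma measurable_rvol_sec n (A : set 'rV[R]_n.+1) : measurable A ->
  measurable_fun setT (fun t => rvol (sec A t)).
Proof.
by move=> mA; apply: measurableT_comp => //; exact: measurable_fun_sec.
Qed.

Lemma rvolS n M (A : set 'rV[R]_n.+1) : 0 < M -> measurable A -> bounded_by M A ->
  (rvol A)%:E = (\int[leb]_t (rvol (sec A t))%:E)%E.
Proof.
move=> M0 mA AM; rewrite (rvolK M0 mA AM) volS; apply: eq_integral => t _.
by rewrite (rvolK M0) //; [exact: measurable_sec|exact: bounded_by_sec].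
Qed.

Lemma superlevel_sec_bounded n M (A : set 'rV[R]_n.+1) r t : bounded_by M A ->
  0 <= r -> r < rvol (sec A t) -> `|t| <= M.
Proof.
move=> AM r0 rt; rewrite leNgt; apply/negP => /(sec_out AM) h.
by move: rt; rewrite h rvol0 ltNge r0.
Qed.

(** Induction on the dimension. The induction hypothesis bounds the product of section volumes of
    [A] and [B] by the square of the section volume of [C] at the midpoint; after normalization by
    the suprema, [integral_midpoint_le] integrates this bound. *)
Theorem brunn_minkowski_midpoint n M (A B C : set 'rV[R]_n) : 0 < M ->
  measurable A -> measurable B -> measurable C ->
  bounded_by M A -> bounded_by M B -> bounded_by M C ->
  (forall a b, A a -> B b -> C (2^-1 *: (a + b))) ->
  rvol A * rvol B <= rvol C ^+ 2.
Proof.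
move=> M0; elim: n => [|n IH] in A B C * => mA mB mC AM BM CM ABC.
  rewrite !rvol_dim0.
  have [A0|_] := boolP (_ \in A); last by rewrite mul0r sqr_ge0.
  have [B0|_] := boolP (_ \in B); last by rewrite mulr0 sqr_ge0.
  rewrite mem_set ?mulr1 ?expr1n //.
  by move: A0 B0; rewrite !inE => A0 B0; have := ABC _ _ A0 B0; rewrite addr0 scaler0.
pose f t := rvol (sec A t); pose g t := rvol (sec B t); pose k t := rvol (sec C t).
have fgk s t : f s * g t <= k ((s + t) / 2) ^+ 2.
  apply: IH; do ?[exact: measurable_sec | exact: bounded_by_sec].
  move=> a b Aa Bb; rewrite /sec /= mulrC.
  by have := ABC _ _ Aa Bb; rewrite rV_consD rV_consZ.
have [V V0 hV] := vol_bounded_by n M0.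
have fV (D : set 'rV[R]_n.+1) t : measurable D -> bounded_by M D -> rvol (sec D t) <= V.
  move=> mD DM; rewrite -lee_fin (rvolK M0) ?hV //; do ?exact: measurable_sec;
    exact: bounded_by_sec.
have supP (D : set 'rV[R]_n.+1) : measurable D -> bounded_by M D ->
    has_sup (range (fun t => rvol (sec D t))).
  move=> mD DM; split; first by exists (rvol (sec D 0)), 0.
  by exists V => _ [t _ <-]; exact: fV.
pose Mf := sup (range f); pose Mg := sup (range g).
have fMf t : f t <= Mf by apply: ub_le_sup; [exact: (supP A mA AM).2|exists t].
have gMg t : g t <= Mg by apply: ub_le_sup; [exact: (supP B mB BM).2|exists t].
have Ef : (rvol A)%:E = (\int[leb]_t (f t)%:E)%E by exact: (rvolS M0).
have Eg : (rvol B)%:E = (\int[leb]_t (g t)%:E)%E by exact: (rvolS M0).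
have Ek : (rvol C)%:E = (\int[leb]_t (k t)%:E)%E by exact: (rvolS M0).
have f0 t : 0 <= f t := rvol_ge0 _.
have g0 t : 0 <= g t := rvol_ge0 _.
have [Mf0|Mf0] := leP Mf 0.
  have -> : rvol A = 0.
    apply: EFin_inj; rewrite Ef integral0_eq // => t _.
    by congr EFin; apply: le_anti; rewrite f0 (le_trans (fMf t)).
  by rewrite mul0r sqr_ge0.
have [Mg0|Mg0] := leP Mg 0.
  have -> : rvol B = 0.
    apply: EFin_inj; rewrite Eg integral0_eq // => t _.
    by congr EFin; apply: le_anti; rewrite g0 (le_trans (gMg t)).
  by rewrite mulr0 sqr_ge0.
(* Dividing [f] by [p ^+ 2] and [g] by [q ^+ 2] gives both the supremum 1; dividing [k] by [p * q]
   then preserves [fgk]. *)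
pose p := Num.sqrt Mf; pose q := Num.sqrt Mg.
have p0 : 0 < p by rewrite sqrtr_gt0.
have q0 : 0 < q by rewrite sqrtr_gt0.
have pE : p ^+ 2 = Mf by rewrite sqr_sqrtr // ltW.
have qE : q ^+ 2 = Mg by rewrite sqr_sqrtr // ltW.
have mf : measurable_fun setT f by exact: measurable_rvol_sec.
have mg : measurable_fun setT g by exact: measurable_rvol_sec.
have mk : measurable_fun setT k by exact: measurable_rvol_sec.
have := @integral_midpoint_le R (fun t => (p ^+ 2)^-1 * f t) (fun t => (q ^+ 2)^-1 * g t)
  (fun t => (p * q)^-1 * k t).
have mZ (c : R) h : measurable_fun setT h -> measurable_fun setT (fun t : R => c * h t).
  by move=> mh; apply: measurable_funM.
have IZ (c : R) (h : R -> R) (a : R) : 0 <= c -> measurable_fun setT h ->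
    (forall t, 0 <= h t) -> a%:E = (\int[leb]_t (h t)%:E)%E ->
    (\int[leb]_t (c * h t)%:E = (c * a)%:E)%E.
  move=> c0 mh h0 hE; under eq_integral do rewrite EFinM.
  rewrite ge0_integralZl //; first by rewrite -hE.
  - exact/measurable_EFinP.
  - by move=> t _; rewrite lee_fin.
have p2 : 0 <= (p ^+ 2)^-1 by rewrite invr_ge0 sqr_ge0.
have q2 : 0 <= (q ^+ 2)^-1 by rewrite invr_ge0 sqr_ge0.
have pq : 0 <= (p * q)^-1 by rewrite invr_ge0 mulr_ge0 // ltW.
rewrite (IZ _ _ _ p2 mf f0 Ef) (IZ _ _ _ q2 mg g0 Eg).
rewrite (IZ _ _ _ pq mk (fun t => rvol_ge0 _) Ek).
rewrite -EFinD -EFinM lee_fin => H.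
have {H} : (p ^+ 2)^-1 * rvol A + (q ^+ 2)^-1 * rvol B <= 2 * ((p * q)^-1 * rvol C).
  apply: H; do ?exact: mZ.
  - by move=> t; rewrite pE mulr_ge0 ?invr_ge0 ?(ltW Mf0) //= ler_pdivrMl // mulr1.
  - by move=> t; rewrite qE mulr_ge0 ?invr_ge0 ?(ltW Mg0) //= ler_pdivrMl // mulr1.
  - by move=> t; exact: mulr_ge0 pq (rvol_ge0 _).
  - move=> r /andP[r0 r1]; split; split.
    + have e0 : 0 < Mf - r * Mf by rewrite -{1}(mul1r Mf) -mulrBl mulr_gt0 ?subr_gt0.
      have [_ [t _ <-] ht] := sup_adherent e0 (supP A mA AM).
      have {}ht : Mf - (Mf - r * Mf) < f t := ht.
      by exists t; rewrite /= pE ltr_pdivlMl //; lra.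
    + exists M => t; rewrite /= pE ltr_pdivlMl // => h.
      apply: le_trans (ler_norm t) _; apply: (superlevel_sec_bounded AM _ h).
      by rewrite mulr_ge0 ?ltW.
    + have e0 : 0 < Mg - r * Mg by rewrite -{1}(mul1r Mg) -mulrBl mulr_gt0 ?subr_gt0.
      have [_ [t _ <-] ht] := sup_adherent e0 (supP B mB BM).
      have {}ht : Mg - (Mg - r * Mg) < g t := ht.
      by exists t; rewrite /= qE ltr_pdivlMl //; lra.
    + exists (- M) => t; rewrite /= qE ltr_pdivlMl // => h.
      suff : `|t| <= M by rewrite ler_norml => /andP[].
      by apply: (superlevel_sec_bounded BM _ h); rewrite mulr_ge0 ?ltW.
  - move=> r s t r0; rewrite !ltr_pdivlMl ?exprn_gt0 ?mulr_gt0 // => h1 h2.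
    rewrite -(@ltr_pXn2r _ 2) // ?nnegrE ?mulr_ge0 ?rvol_ge0 ?ltW //.
    apply: lt_le_trans (fgk s t).
    rewrite (_ : _ ^+ 2 = (p ^+ 2 * r) * (q ^+ 2 * r)); last by ring.
    by apply: ltr_pM => //; rewrite mulr_ge0 ?exprn_ge0 ?ltW.
set a := rvol A; set b := rvol B; set c := rvol C => H.
have {}H : a * (q / p) + b * (p / q) <= 2 * c.
  have : (p * q) * ((p ^+ 2)^-1 * a + (q ^+ 2)^-1 * b) <= (p * q) * (2 * ((p * q)^-1 * c)).
    by rewrite ler_pM2l // mulr_gt0.
  congr (_ <= _); by field; rewrite !gt_eqF.
(* The unknown ratio of [p] and [q] cancels in the product of the two summands, so the inequality
   between arithmetic and geometric means concludes. *)
have xy : (a * (q / p)) * (b * (p / q)) = a * b by field; rewrite !gt_eqF.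
rewrite -xy; move: H; set x := a * _; set y := b * _.
have x0 : 0 <= x by rewrite mulr_ge0 ?rvol_ge0 // divr_ge0 // ltW.
have y0 : 0 <= y by rewrite mulr_ge0 ?rvol_ge0 // divr_ge0 // ltW.
move=> H; have := sqr_ge0 (x - y); have c0 : 0 <= c := rvol_ge0 _.
have : (x + y) * (x + y) <= (2 * c) * (2 * c) by apply: ler_pM => //; exact: addr_ge0.
by nra.
Qed.

End brunn_minkowski.

(** * The equality case in one dimension *)

Section real_line.
Context {R : realType}.

(** Suppose [z] is missing between [x] and [y], and let [u] be the end of the stretch of [E] that
    starts at [x]. Openness excludes [u] from [E], yet points of [E] accumulate at [u] from the
    right, so [u] is a midpoint of two points of [E]. *)
Lemma open_midpoint_interval (E : set R) : open E ->
  (forall x y, E x -> E y -> E ((x + y) / 2)) -> is_interval E.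
Proof.
move=> oE mE x y Ex Ey z /andP[xz zy]; apply: contrapT => nEz.
have oEP v : E v -> exists2 e : R, 0 < e & forall w, `|v - w| < e -> E w.
  move=> Ev; have /nbhs_ballP[e /= e0 eE] : nbhs v E by exact: open_nbhs_nbhs.
  by exists e.
pose S := [set u | x <= u /\ forall w, x <= w <= u -> E w].
have Sz u : S u -> u <= z.
  move=> [xu hu]; rewrite leNgt; apply/negP => zu; apply: nEz; apply: hu.
  by rewrite xz ltW.
have Sx : S x by split => // w h; have -> : w = x by apply/eqP; rewrite eq_le andbC.
have supS : has_sup S by split; [exists x | exists z].
pose u := sup S.
have uz : u <= z by apply: ge_sup => //; exists x.
have xu : x <= u by apply: ub_le_sup; [exists z|].
have Elt w : x <= w < u -> E w.
  move=> /andP[xw wu]; have uw0 : 0 < u - w by rewrite subr_gt0.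
  have [v [_ hv] wv] := sup_adherent uw0 supS.
  by apply: hv; rewrite xw; move: wv; rewrite -/u; lra.
have nEu : ~ E u.
  move=> Eu; have [e e0 he] := oEP u Eu.
  suff /(ub_le_sup (ex_intro _ z Sz)) : S (u + e / 2) by rewrite -/u; lra.
  split; first by lra.
  move=> w /andP[xw wu]; have [wu'|uw] := ltP w u; first by apply: Elt; rewrite xw.
  by apply: he; rewrite ltr_norml; apply/andP; split; lra.
have {}xu : x < u.
  by rewrite lt_neqAle xu andbT; apply/eqP => xu'; apply: nEu; rewrite -xu'.
have uy : u < y.
  by rewrite lt_neqAle (le_trans uz zy) andbT; apply/eqP => uy'; apply: nEu; rewrite uy'.
pose T := [set v | E v /\ u < v].
have infT : has_inf T by split; [exists y | exists u => v [_ /ltW]].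
(* Averaging [v] with a point of [E] to the left of [u], but closer to [u] than [v] is, at least
   halves the distance to [u] and stays on its right. *)
have half v : T v -> exists2 v', T v' & v' <= (u + v) / 2.
  move=> [Ev uv].
  have [w /andP[w1 w2]] : exists w, Num.max x (2 * u - v) < w < u.
    have h : Num.max x (2 * u - v) < u by rewrite gt_max xu /=; lra.
    by exists ((Num.max x (2 * u - v) + u) / 2); apply/andP; split; lra.
  move: w1; rewrite gt_max => /andP[xw vw].
  exists ((w + v) / 2); last by lra.
  by split; [apply: mE => //; apply: Elt; rewrite (ltW xw)|lra].
have iu : inf T <= u.
  rewrite leNgt; apply/negP => ui; have d0 : 0 < inf T - u by rewrite subr_gt0.
  have [v Tv vi] := inf_adherent d0 infT.
  have [v' Tv' v'v] := half v Tv.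
  have : inf T <= v' by apply: ge_inf => //; case: infT.
  by move: vi; lra.
have d0 : 0 < u - x by rewrite subr_gt0.
(* Here [t] is closer to [u] than [x] is, so its mirror image [2 * u - t] falls between [x] and [u],
   hence in [E]. *)
have [t [Et ut] ti] := inf_adherent d0 infT.
apply: nEu; have := mE (2 * u - t) t.
have -> : (2 * u - t + t) / 2 = u by field.
by apply => //; apply: Elt; apply/andP; split; lra.
Qed.

Lemma open_interval_inf_sup (E : set R) : open E -> is_interval E -> has_inf E -> has_sup E ->
  E = `]inf E, sup E[%classic.
Proof.
move=> oE iE hi hs; apply/seteqP; split => [x Ex|x] /=; rewrite in_itv /=.
  have /nbhs_ballP[e /= e0 eE] : nbhs x E by exact: open_nbhs_nbhs.
  have h1 : inf E <= x - e / 2.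
    apply: ge_inf; [by case: hi|apply: eE].
    by rewrite /ball /= ltr_norml; apply/andP; split; lra.
  have h2 : x + e / 2 <= sup E.
    apply: ub_le_sup; [by case: hs|apply: eE].
    by rewrite /ball /= ltr_norml; apply/andP; split; lra.
  by apply/andP; split; lra.
move=> /andP[h1 h2].
have d1 : 0 < x - inf E by rewrite subr_gt0.
have d2 : 0 < sup E - x by rewrite subr_gt0.
have [a Ea ha] := inf_adherent d1 hi.
have [b Eb hb] := sup_adherent d2 hs.
by apply: (iE a b) => //; apply/andP; split; lra.
Qed.

(* Along an arithmetic progression the bounds telescope to a single increment of [W]; increments
   only grow in size beyond it while [W] stays nonnegative, so it is at most [W y] divided by the
   number of steps that still fit below [Y]. *)
Lemma second_difference_cst (C W : R -> R) (Y : R) :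
  (forall x y, x <= Y -> y <= Y ->
    `|C x - C y| <= 2 * W ((x + y) / 2) - W x - W y) ->
  (forall x, x <= Y -> 0 <= W x) ->
  (forall x y, x <= y -> y <= Y -> W y <= W x) ->
  forall x y, x <= y -> y < Y -> C x = C y.
Proof.
move=> HC W0 Wd x y xy yY.
have dY : 0 < Y - y by rewrite subr_gt0.
(* With this choice [(y - x) / q%:R] is at most [Y - y], the room left above [y]. *)
pose q := (Num.truncn ((y - x) / (Y - y))).+1.
have qP : y - x <= q%:R * (Y - y).
  by rewrite -ler_pdivrMr // ltW // truncnS_gt.
have q0 : 0 < q%:R :> R by rewrite ltr0n.
suff H m : m.+1%:R * `|C x - C y| <= W y.
  apply/eqP; rewrite -subr_eq0 -normr_le0 leNgt; apply/negP => c0.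
  have := H (Num.truncn (W y / `|C x - C y|)).
  by rewrite -ler_pdivlMr // leNgt truncnS_gt.
(* The progression reaches [y] after [N] steps, and [e] further steps still fit below [Y]. Doubling
   makes [N] even, as the bound on [C] advances by two indices at a time. *)
pose e := (m.+1).*2; pose N := (q * e)%N.
pose h := (y - x) / N%:R.
have e0 : 0 < e%:R :> R by rewrite ltr0n double_gt0.
have N0 : 0 < N%:R :> R by rewrite ltr0n muln_gt0 double_gt0.
have h0 : 0 <= h by rewrite divr_ge0 ?subr_ge0 // ltW.
pose p j := x + j%:R * h.
have pN : p N = y by rewrite /p /h mulrC divfK ?gt_eqF //; lra.
have eh : e%:R * h <= Y - y.
  have -> : e%:R * h = (y - x) / q%:R by rewrite /h /N natrM; field; rewrite !gt_eqF.
  by rewrite ler_pdivrMr // mulrC.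
have pmono i j : (i <= j)%N -> p i <= p j.
  by move=> ij; rewrite lerD2l ler_wpM2r // ler_nat.
have pY j : (j <= N + e)%N -> p j <= Y.
  move=> /pmono /le_trans; apply; rewrite /p natrD mulrDl addrA -/(p N) pN; lra.
pose D j := W (p j) - W (p j.+1).
have DD j : (j.+2 <= N + e)%N -> `|C (p j) - C (p j.+2)| <= D j.+1 - D j.
  move=> jN; apply: le_trans (HC _ _ (pY _ _) (pY _ jN)) _.
    by rewrite (leq_trans _ jN) // leqW.
  have -> : (p j + p j.+2) / 2 = p j.+1 by rewrite /p -(natr1 j.+1) -(natr1 j); field.
  by rewrite /D; lra.
have Dm j : (j.+2 <= N + e)%N -> D j <= D j.+1.
  by move=> /DD /(le_trans (normr_ge0 _)); rewrite subr_ge0.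
have CD i : (i.*2 <= N)%N -> `|C (p 0%N) - C (p i.*2)| <= D i.*2 - D 0%N.
  elim: i => [|i IH]; first by rewrite !subrr normr0.
  rewrite doubleS => iN; apply: le_trans (ler_distD (C (p i.*2)) _ _) _.
  have i1 : (i.*2.+2 <= N + e)%N by rewrite (leq_trans iN) // leq_addr.
  have i2 : (i.*2.+3 <= N + e)%N.
    by apply: leq_ltn_trans iN _; rewrite -addn1 leq_add2l double_gt0.
  have := IH (leq_trans (leqW (leqnSn _)) iN); have := DD _ i1; have := Dm _ i2.
  by lra.
have DN i : (i <= e)%N -> i%:R * D N <= W (p N) - W (p (N + i)%N) /\
    ((i < e)%N -> D N <= D (N + i)%N).
  elim: i => [_|i IH ie]; first by rewrite addn0 mul0r subrr.
  have [h1 h2] := IH (ltnW ie); have {}h2 := h2 ie.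
  split; last first.
    move=> ie2; apply: le_trans h2 _; rewrite addnS; apply: Dm.
    by rewrite -!addnS leq_add2l.
  by rewrite -natr1 mulrDl mul1r addnS; move: h2; rewrite {2}/D; lra.
have [De _] := DN e (leqnn _).
have D00 : 0 <= D 0%N by rewrite subr_ge0; apply: Wd (pmono _ _ _) (pY _ _).
have NE : N = (q * m.+1).*2 by rewrite /N /e -!muln2 mulnA.
have := CD (q * m.+1)%N; rewrite -NE => /(_ (leqnn _)); rewrite pN.
have -> : p 0%N = x by rewrite /p mul0r addr0.
have := W0 _ (pY (N + e)%N (leqnn _)); move: De; rewrite pN.
have -> : e%:R = m.+1%:R + m.+1%:R :> R by rewrite /e -addnn natrD.
have : 0 < m.+1%:R :> R by rewrite ltr0n.
set k := m.+1%:R; set a := `| _ |; move=> k0 h1 h2 h3.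
have ka : k * a <= k * D N by rewrite ler_pM2l //; lra.
have : 0 <= k * a by apply: mulr_ge0; [exact: ltW|exact: normr_ge0].
by nra.
Qed.

End real_line.

(** * The half difference body *)

Section half_difference.
Context {R : realType}.
Local Notation leb := (@lebesgue_measure R).

Definition half_diff n (A : set 'rV[R]_n) : set 'rV[R]_n :=
  [set z | exists x y, [/\ A x, A y & z = 2^-1 *: (x - y)]].

Lemma open_half_diff n (A : set 'rV[R]_n) : open A -> open (half_diff A).
Proof.
move=> /open_cubeP oA; apply/open_cubeP => _ [x [y [Ax Ay ->]]].
have [e e0 eA] := oA x Ax; exists (e / 2); first by rewrite divr_gt0.
move=> w hw; exists (2 *: w + y), y; split => //; last first.
  by rewrite addrK scalerA mulVf ?scale1r.
apply: eA => i; have := hw i; rewrite !mxE.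
have -> : 2 * w ord0 i + y ord0 i - x ord0 i =
  2 * (w ord0 i - 2^-1 * (x ord0 i - y ord0 i)) by field.
by rewrite normrM ger0_norm //; lra.
Qed.

Lemma bounded_by_half_diff n M (A : set 'rV[R]_n) : bounded_by M A ->
  bounded_by M (half_diff A).
Proof.
move=> AM _ [x [y [/AM Ax /AM Ay ->]]] i; rewrite !mxE.
have := Ax i; have := Ay i; rewrite !ler_norml => /andP[? ?] /andP[? ?].
by apply/andP; split; lra.
Qed.

Lemma rvol_opp n (A : set 'rV[R]_n) : measurable A -> rvol [set x | A (- x)] = rvol A.
Proof.
move=> mA; rewrite /rvol -[in RHS](@vol_affine _ n (- 1) 0) ?normrN1 //.
by congr (fine (lebesgue_measure_rV _ _)); apply/seteqP; split => x /=; rewrite scaleN1r addr0.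
Qed.

Lemma measurable_opp n (A : set 'rV[R]_n) : measurable A -> measurable [set x | A (- x)].
Proof.
move=> mA; have := measurable_preimage (@measurable_rV_affine R n (- 1) 0) mA.
by congr (measurable _); apply/seteqP; split => x /=; rewrite scaleN1r addr0.
Qed.

Lemma bounded_by_opp n M (A : set 'rV[R]_n) : bounded_by M A -> bounded_by M [set x | A (- x)].
Proof. by move=> AM x /AM + i => /(_ i); rewrite mxE normrN. Qed.

(** Brunn-Minkowski for the section at [s] and the reflection of the section at [t], whose volume is
    that of the section itself. *)
Lemma rvol_sec_half_diff n M (A : set 'rV[R]_n.+1) s t : 0 < M -> open A -> bounded_by M A ->
  rvol (sec A s) * rvol (sec A t) <= rvol (sec (half_diff A) ((s - t) / 2)) ^+ 2.
Proof.
move=> M0 oA AM; have mA := open_measurable_rV oA.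
rewrite -(rvol_opp (measurable_sec t mA)).
apply: (brunn_minkowski_midpoint M0).
- exact: measurable_sec.
- exact: (measurable_opp (measurable_sec t mA)).
- exact: measurable_sec (open_measurable_rV (open_half_diff oA)).
- exact: bounded_by_sec.
- by apply: (@bounded_by_opp _ _ (sec A t)); exact: bounded_by_sec.
- by apply: bounded_by_sec; exact: bounded_by_half_diff.
move=> a b Aa Ab; exists (rV_cons (s, a)), (rV_cons (t, - b)); split => //.
by rewrite rV_consN rV_consD rV_consZ opprK mulrC.
Qed.

Lemma rvol_sec_midpoint n M (A : set 'rV[R]_n.+1) s t : 0 < M -> measurable A ->
  bounded_by M A ->
  (forall x y, A x -> A y -> A (2^-1 *: (x + y))) ->
  rvol (sec A s) * rvol (sec A t) <= rvol (sec A ((s + t) / 2)) ^+ 2.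
Proof.
move=> M0 mA AM mid; apply: (brunn_minkowski_midpoint M0);
  do ?[exact: measurable_sec | exact: bounded_by_sec].
move=> a b Aa Ab; have := mid _ _ Aa Ab.
by rewrite rV_consD rV_consZ mulrC.
Qed.

(** An exhaustion of an open set with a margin: a translation by less than [k.+1%:R^-1] in each
    coordinate does not leave [A]. The strict inequality on [e] keeps these sets open. *)
Definition inner n (A : set 'rV[R]_n) (k : nat) : set 'rV[R]_n :=
  [set x | exists2 e : R, k.+1%:R^-1 < e & cube x e `<=` A].

Lemma inner_sub n (A : set 'rV[R]_n) k : inner A k `<=` A.
Proof.
move=> x [e ke]; apply => i; rewrite subrr normr0.
by apply: lt_trans ke; rewrite invr_gt0.
Qed.

Lemma open_inner n (A : set 'rV[R]_n) k : open (inner A k).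
Proof.
apply/open_cubeP => x [e ke eA].
exists ((e - k.+1%:R^-1) / 2); first by rewrite divr_gt0 // subr_gt0.
move=> y xy; exists ((e + k.+1%:R^-1) / 2).
  by move: ke; set d := _^-1; lra.
move=> w yw; apply: eA => i; have := yw i; have := xy i.
set d := k.+1%:R^-1; rewrite !ltr_norml => /andP[? ?] /andP[? ?].
by apply/andP; split; lra.
Qed.

Lemma subset_inner n (A : set 'rV[R]_n) i j : (i <= j)%N -> inner A i `<=` inner A j.
Proof.
move=> ij x [e ke eA]; exists e => //; apply: le_lt_trans ke.
by rewrite lef_pV2 ?posrE // ler_nat ltnS.
Qed.

Lemma bigcup_inner n (A : set 'rV[R]_n) : open A -> \bigcup_k inner A k = A.
Proof.
move=> /open_cubeP oA; apply/seteqP; split => [x [k _]|x Ax]; first exact: inner_sub.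
have [e e0 eA] := oA _ Ax.
have [k _ /(_ k (leqnn k)) ke] := near_infty_natSinv_lt (PosNum e0).
by exists k => //; exists e.
Qed.

(** Lower semicontinuity of the section volume. By continuity from below, the section of some
    [inner A k] at [t] already has volume above [r], and it is contained in every section of [A] at
    distance less than [k.+1%:R^-1]. *)
Lemma open_superlevel_sec n M (A : set 'rV[R]_n.+1) r : 0 < M -> open A -> bounded_by M A ->
  open ([set t : R | r < rvol (sec A t)] : set R).
Proof.
move=> M0 oA AM; have mA := open_measurable_rV oA.
rewrite openE => t /= rt.
pose F k := sec (inner A k) t.
have mF k : measurable (F k) by apply: measurable_sec; apply: open_measurable_rV;
  exact: open_inner.
have FA : \bigcup_k F k = sec A t.
  apply/seteqP; split => [y [k _]|y]; first exact: inner_sub.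
  by rewrite /sec /= -{1}(bigcup_inner oA) => -[k _ ?]; exists k.
have ndF : nondecreasing_seq F.
  by move=> i j ij; apply/subsetPset => y; exact: subset_inner ij _.
have cvg := nondecreasing_cvg_mu (mu := lebesgue_measure_rV n) mF.
have {}cvg := cvg (bigcup_measurable (fun k _ => mF k)) ndF.
rewrite FA in cvg.
have rt' : (r%:E < lebesgue_measure_rV n (sec A t))%E.
  by rewrite -(rvolK M0) ?lte_fin //; [exact: measurable_sec|exact: bounded_by_sec].
have [k _ /(_ k (leqnn k)) rk] := cvg _ (open_ereal_gt' rt').
apply/nbhs_ballP; exists k.+1%:R^-1; first by rewrite /= invr_gt0.
move=> s; rewrite /ball /= => ts.
have Fs : F k `<=` sec A s.
  move=> y [e ke eA]; apply: eA => i.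
  case: (unliftP ord0 i) => [j ->|->]; last by rewrite !rV_cons_fst distrC (lt_trans ts).
  by rewrite !rV_cons_snd subrr normr0 (lt_trans _ ke) // invr_gt0.
rewrite -lte_fin (rvolK M0); [|exact: measurable_sec|exact: bounded_by_sec].
apply: lt_le_trans rk _; apply: le_measure => //; rewrite inE //.
exact: measurable_sec.
Qed.

End half_difference.

(** * Equality in one dimension: the superlevel intervals are concentric *)

Lemma ltr_sqr_ge0 (R : realDomainType) (x y : R) : 0 <= y -> x ^+ 2 < y ^+ 2 -> x < y.
Proof. by move=> y0; rewrite !ltNge; apply: contra => yx; rewrite !expr2 ler_pM. Qed.

Section equality_case.
Context {R : realType} (M : R) (f k : R -> R).
Local Notation leb := (@lebesgue_measure R).
Hypotheses (mf : measurable_fun setT f) (mk : measurable_fun setT k).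
Hypotheses (f0 : forall t, 0 <= f t) (k0 : forall t, 0 <= k t).
Hypothesis f_supp : forall t, 0 < f t -> `|t| <= M.
Hypothesis f_lsc : forall r, open ([set t : R | r < f t] : set R).
Hypothesis f_mid : forall s t, f s * f t <= f ((s + t) / 2) ^+ 2.
Hypothesis fk_mid : forall s t, f s * f t <= k ((s - t) / 2) ^+ 2.
Hypothesis f_int : (\int[leb]_t (f t)%:E < +oo)%E.
Hypothesis kf_int : (\int[leb]_t (k t)%:E <= \int[leb]_t (f t)%:E)%E.

Let F r : set R := [set t | r < f t].
Let G r : set R := [set t | r < k t].

Let mF r : measurable (F r). Proof. exact: measurable_superlevel. Qed.
Let mG r : measurable (G r). Proof. exact: measurable_superlevel. Qed.

Let FM r t : 0 <= r -> F r t -> `|t| <= M.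
Proof. by move=> r0 rt; apply: f_supp; exact: le_lt_trans rt. Qed.

Let F_bounded r : 0 <= r -> F r !=set0 -> has_inf (F r) /\ has_sup (F r).
Proof.
move=> r0 F0; split; split => //; [exists (- M) => t|exists M => t] => /(FM r0);
  by rewrite ler_norml => /andP[].
Qed.

(** The superlevel set is open by [f_lsc] and closed under midpoints by [f_mid], hence an open
    interval. *)
Let FE r : 0 <= r -> F r !=set0 -> F r = `]inf (F r), sup (F r)[%classic.
Proof.
move=> r0 F0; have [Fi Fs] := F_bounded r0 F0.
have oF : open (F r) by exact: f_lsc.
apply: open_interval_inf_sup => //; apply: open_midpoint_interval => // s t Fs' Ft.
apply: ltr_sqr_ge0 => //; apply: lt_le_trans (f_mid s t).
by rewrite expr2; apply: ltr_pM.
Qed.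

Let inf_lt_sup r : 0 <= r -> F r !=set0 -> inf (F r) < sup (F r).
Proof.
move=> r0 F0; have [t] := F0; rewrite {1}(FE r0 F0) /= in_itv /= => /andP[].
exact: lt_trans.
Qed.

Let lebF r : 0 <= r -> F r !=set0 -> leb (F r) = (sup (F r) - inf (F r))%:E.
Proof.
move=> r0 F0; by rewrite {1}FE // lebesgue_measure_itv /= lte_fin inf_lt_sup.
Qed.

Let FGk r s t : 0 <= r -> forall a b, 0 <= a -> 0 <= b -> r ^+ 2 = a * b ->
  F a s -> F b t -> G r ((s - t) / 2).
Proof.
move=> r0 a b a0 b0 rE Fs Ft; apply: ltr_sqr_ge0 => //.
by apply: lt_le_trans (fk_mid s t); rewrite rE; apply: ltr_pM.
Qed.

(* The intervals [({f > a} - {f > b}) / 2] and its opposite overlap and both lie in [{k > r}]. *)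
Let lebG_bound a b r : 0 <= r -> 0 <= a -> 0 <= b -> r ^+ 2 = a * b ->
  F a !=set0 -> F b !=set0 -> a <= b ->
  ((sup (F a) - inf (F b))%:E <= leb (G r))%E /\ ((sup (F b) - inf (F a))%:E <= leb (G r))%E.
Proof.
move=> r0 a0 b0 rE Fa Fb ab.
have FS : F b `<=` F a by move=> t /(le_lt_trans ab).
have [t Fbt] := Fb; have Fat := FS _ Fbt.
have Ea := FE a0 Fa; have Eb := FE b0 Fb.
set a1 := inf (F a) in Ea *; set a2 := sup (F a) in Ea *.
set b1 := inf (F b) in Eb *; set b2 := sup (F b) in Eb *.
have := Fat; have := Fbt; rewrite Ea Eb /= !in_itv /= => /andP[b1t tb2] /andP[a1t ta2].
have key (m : R) : 0 < m -> (forall p, 0 <= p -> p < m ->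
    G r p /\ G r (- p)) -> ((2 * m)%:E <= leb (G r))%E.
  move=> m0 Gm; have -> : (2 * m)%:E = leb `](- m), m[.
    rewrite lebesgue_measure_itv /= lte_fin gtrN // -EFinD; congr EFin; ring.
  apply: le_measure; rewrite ?inE //; first exact: mG.
  move=> p /=; rewrite in_itv /= => /andP[p1 p2].
  have [p0|p0] := leP 0 p; first by have [] := Gm p p0 p2.
  have np : - p < m by lra.
  have np0 : 0 <= - p by lra.
  by have [_] := Gm _ np0 np; rewrite opprK.
have swap s u : F a s -> F b u -> G r ((s - u) / 2) /\ G r (- ((s - u) / 2)).
  move=> Fs Fu; split; first exact: (FGk r0 a0 b0).
  rewrite -mulNr opprB; apply: (FGk r0 b0 a0) => //; by rewrite mulrC.
split.
- rewrite (_ : a2 - b1 = 2 * ((a2 - b1) / 2)); last by field.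
  apply: key => [|p p0 pm]; first by lra.
  (* To write [p] as [(s - u) / 2] with [s] in [F a] and [u] in [F b], the point [s] must lie in
     []a1, a2[] and in []b1 + 2 * p, b2 + 2 * p[]; the midpoint of the intersection is taken. *)
  pose lo := Num.max a1 (b1 + 2 * p); pose hi := Num.min a2 (b2 + 2 * p).
  have lohi : lo < hi by rewrite /lo /hi gt_max !lt_min; apply/andP; split; apply/andP;
    split; lra.
  have [h1 h2] : lo < (lo + hi) / 2 /\ (lo + hi) / 2 < hi by split; lra.
  move: h1 h2; set s := (lo + hi) / 2; rewrite gt_max lt_min => /andP[s1 s2] /andP[s3 s4].
  have := swap s (s - 2 * p); rewrite (_ : (s - (s - 2 * p)) / 2 = p); last by field.
  apply; rewrite ?Ea ?Eb /= in_itv /=; apply/andP; split; lra.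
- rewrite (_ : b2 - a1 = 2 * ((b2 - a1) / 2)); last by field.
  apply: key => [|p p0 pm]; first by lra.
  pose lo := Num.max b1 (a1 + 2 * p); pose hi := Num.min b2 (a2 + 2 * p).
  have lohi : lo < hi by rewrite /lo /hi gt_max !lt_min; apply/andP; split; apply/andP;
    split; lra.
  have [h1 h2] : lo < (lo + hi) / 2 /\ (lo + hi) / 2 < hi by split; lra.
  move: h1 h2; set s := (lo + hi) / 2; rewrite gt_max lt_min => /andP[s1 s2] /andP[s3 s4].
  have := swap (s - 2 * p) s; rewrite (_ : (s - 2 * p - s) / 2 = - p); last by field.
  rewrite opprK and_comm; apply; rewrite ?Ea ?Eb /= in_itv /=; apply/andP; split; lra.
Qed.

Let le_lebFG r : 0 < r -> (leb (F r) <= leb (G r))%E.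
Proof.
move=> r0; have [->|/set0P F0] := eqVneq (F r) set0; first by rewrite measure0.
rewrite (lebF (ltW r0) F0).
by have [] := lebG_bound (ltW r0) (ltW r0) (ltW r0) (expr2 r) F0 F0 (lexx r).
Qed.

(* By layer cake a strict inequality at one level [r] would persist at the levels just above it,
   contradicting [kf_int]. *)
Let le_lebGF r : 0 < r -> (leb (G r) <= leb (F r))%E.
Proof.
move=> r0; rewrite leNgt; apply/negP => FG.
have GU : \bigcup_i G (r + i.+1%:R^-1) = G r.
  apply/seteqP; split => [t [i _]|t rt].
    by apply: le_lt_trans; rewrite lerDl invr_ge0.
  have d0 : 0 < k t - r by rewrite subr_gt0.
  have [i _ /(_ i (leqnn i)) /= ki] := near_infty_natSinv_lt (PosNum d0).
  by exists i => //; rewrite /G /= -ltrBrDl.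
have ndG : nondecreasing_seq (fun i => G (r + i.+1%:R^-1)).
  move=> i j ij; apply/subsetPset => t; apply: le_lt_trans.
  by rewrite lerD2l lef_pV2 ?posrE // ler_nat ltnS.
have cvg := nondecreasing_cvg_mu (mu := leb) (fun i => mG (r + i.+1%:R^-1)).
have {}cvg := cvg (bigcup_measurable (fun i _ => mG _)) ndG.
rewrite GU in cvg.
have Ffin : (leb (F r) \is a fin_num)%E.
  rewrite ge0_fin_numE ?measure_ge0 //.
  have [->|/set0P F0] := eqVneq (F r) set0; first by rewrite measure0 ltry.
  by rewrite (lebF (ltW r0) F0) ltry.
rewrite -(fineK Ffin) in FG.
have [i _ /(_ i (leqnn i)) /= FGi] := cvg _ (open_ereal_gt' FG).
rewrite fineK // in FGi.
set r1 := r + i.+1%:R^-1 in FGi.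
have rr1 : r < r1 by rewrite ltrDl invr_gt0.
(* If [G r1] has infinite measure any positive gap will do, and 1 is taken. *)
have [D D0 FDG] : exists2 D : R, 0 < D & (leb (F r) + D%:E <= leb (G r1))%E.
  move: FGi; rewrite -(fineK Ffin); case: (leb (G r1)) => [g| |] //.
    by rewrite lte_fin => h; exists (g - fine (leb (F r))); rewrite ?subr_gt0 //
      -EFinD lee_fin subrKC.
  by move=> _; exists 1 => //; rewrite leey.
(* Between [r] and [r1] the measures of [F s] and [G s] are squeezed by those of [F r] and [G r1],
   so the gap [D] is inherited; elsewhere [le_lebFG] suffices. *)
have FDG' s : 0 < s -> (leb (F s) + D%:E * (\1_`]r, r1[ s)%:E <= leb (G s))%E.
  move=> s0; rewrite indicE; case: (boolP (_ \in _)) => [|_];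
    last by rewrite mule0 adde0 le_lebFG.
  rewrite inE /= in_itv /= => /andP[rs sr1]; rewrite mule1.
  apply: le_trans (_ : leb (F r) + D%:E <= _)%E.
    rewrite leeD2r // le_measure ?inE //; try exact: mF.
    by move=> t; exact: lt_trans.
  apply: le_trans FDG _; rewrite le_measure ?inE //; try exact: mG.
  by move=> t; exact: lt_trans.
move: kf_int; rewrite leNgt => /negP; apply.
rewrite layer_cake // [ltRHS]layer_cake //.
have Ifin : (\int[leb]_(s in `]0%R, +oo[) leb (F s) \is a fin_num)%E.
  rewrite ge0_fin_numE; last by apply: integral_ge0.
  by rewrite -layer_cake.
have Dr : (0 < (D * (r1 - r))%:E)%E by rewrite lte_fin mulr_gt0 // subr_gt0.
apply: (@lt_le_trans _ _ (\int[leb]_(s in `]0%R, +oo[) (leb (F s) + D%:E * (\1_`]r, r1[ s)%:E))%E).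
  rewrite ge0_integralD //.
  - rewrite ge0_integralZl //; last 2 first.
    + exact/measurable_EFinP/measurable_indic.
    + by rewrite lee_fin ltW.
    rewrite integral_indic // setIidl; last first.
      by move=> s /=; rewrite !in_itv /= andbT => /andP[/(lt_trans r0)].
    rewrite /= lebesgue_measure_itv /= lte_fin rr1 -EFinD -EFinM.
    by rewrite lteDl.
  - exact: measurable_fun_superlevel.
  - by move=> s _; apply: mule_ge0; rewrite lee_fin //; exact: ltW.
  - by apply: measurable_funeM; exact/measurable_EFinP/measurable_indic.
apply: ge0_le_integral => //.
- by move=> s _; apply: adde_ge0 => //; apply: mule_ge0; rewrite lee_fin //; exact: ltW.
- apply: emeasurable_funD; first exact: measurable_fun_superlevel.
  by apply: measurable_funeM; exact/measurable_EFinP/measurable_indic.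
- exact: measurable_fun_superlevel.
- by move=> s; rewrite /= in_itv /= andbT; exact: FDG'.
Qed.

Let a_ r := inf (F r).
Let b_ r := sup (F r).

(** The two signs of the absolute value correspond to the bounds of [b_ a - a_ b] and of
    [b_ b - a_ a] by [b_ r - a_ r], obtained by comparing [G r] with [F r]. *)
Let center_bound a b r : 0 < r -> 0 < a -> 0 < b -> r ^+ 2 = a * b ->
  F a !=set0 -> F b !=set0 -> F r !=set0 ->
  `|(a_ a + b_ a) - (a_ b + b_ b)| <=
   2 * (b_ r - a_ r) - (b_ a - a_ a) - (b_ b - a_ b).
Proof.
move=> r0.
wlog ab : a b / a <= b => [H a0 b0 rE Fa Fb Fr|].
  have [ab|/ltW ba] := leP a b; first exact: H.
  by rewrite distrC [leRHS]addrAC; apply: H => //; rewrite mulrC.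
move=> a0 b0 rE Fa Fb Fr.
have [] := lebG_bound (ltW r0) (ltW a0) (ltW b0) rE Fa Fb ab.
have := le_lebGF r0; rewrite (lebF (ltW r0) Fr) => GF.
move=> /le_trans/(_ GF) + /le_trans/(_ GF).
rewrite !lee_fin -/(a_ a) -/(b_ a) -/(a_ b) -/(b_ b) -/(a_ r) -/(b_ r) => h1 h2.
by rewrite ler_norml; apply/andP; split; lra.
Qed.

Let F_nonempty r s : r <= s -> F s !=set0 -> F r !=set0.
Proof. by move=> rs [t st]; exists t; exact: le_lt_trans st. Qed.

Let F_sub r s : r <= s -> F s `<=` F r.
Proof. by move=> rs t; exact: le_lt_trans. Qed.

(** Under the substitution [r = expR x] geometric means of levels become midpoints, and
    [center_bound] becomes the hypothesis of [second_difference_cst]. *)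
Let center_cst a b : 0 < a -> a <= b -> F b !=set0 -> a_ a + b_ a = a_ b + b_ b.
Proof.
move=> a0 ab [t Fbt]; have b0 : 0 < b by exact: lt_le_trans ab.
(* A level strictly above [b] that is still attained: [second_difference_cst] needs room above its
   right end. *)
pose c := (b + f t) / 2.
have bt : b < f t := Fbt.
have bc : b < c by rewrite /c; lra.
have Fc : F c !=set0 by exists t; rewrite /F /= /c; lra.
have c0 : 0 < c by exact: lt_trans bc.
have Fx x : x <= ln c -> F (expR x) !=set0.
  by move=> xc; apply: F_nonempty Fc; rewrite -[leRHS]lnK // ler_expR.
have := @second_difference_cst R (fun x => a_ (expR x) + b_ (expR x))
  (fun x => b_ (expR x) - a_ (expR x)) (ln c).
move=> /(_ _ _ _ (ln a) (ln b)); rewrite !lnK ?posrE //; apply.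
- move=> x y xc yc; apply: center_bound; rewrite ?expR_gt0 //.
  + by rewrite -expRM_natl -expRD; congr expR; field.
  + exact: Fx.
  + exact: Fx.
  + by apply: Fx; lra.
- by move=> x xc; rewrite subr_ge0 ltW //; apply: inf_lt_sup (Fx _ xc); exact: expR_ge0.
- move=> x y xy yc; have xc := le_trans xy yc.
  have [Fyi Fys] := F_bounded (expR_ge0 y) (Fx y yc).
  have [Fxi Fxs] := F_bounded (expR_ge0 x) (Fx x xc).
  have sub : F (expR y) `<=` F (expR x) by apply: F_sub; rewrite ler_expR.
  apply: lerB.
    by apply: ge_sup => [|u /sub Fu]; [case: Fys|apply: ub_le_sup => //; case: Fxs].
  by apply: lb_le_inf => [|u /sub Fu]; [case: Fyi|apply: ge_inf => //; case: Fxi].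
- by rewrite ler_ln ?posrE.
- by rewrite ltr_ln ?posrE.
Qed.

Lemma midpoint_equality_symmetric : exists c, forall t, f (c - t) = f t.
Proof.
have [Fn|/existsNP[r0]] := pselect (forall r, 0 < r -> F r = set0).
  have fE t : f t = 0.
    apply: le_anti; rewrite f0 andbT leNgt; apply/negP => ft.
    have : F (f t / 2) t by rewrite /F /=; lra.
    by rewrite Fn //; lra.
  by exists 0 => t; rewrite !fE.
rewrite not_implyP => -[r00 /eqP/set0P Fr0].
exists (a_ r0 + b_ r0) => t.
suff H s : f s <= f (a_ r0 + b_ r0 - s).
  by apply: le_anti; rewrite H andbT; apply: le_trans (H _) _; rewrite subKr.
rewrite leNgt; apply/negP => fs.
(* A level separating the two values: [F r] would contain [s] but not its mirror image in the common
   center. *)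
pose r := (f (a_ r0 + b_ r0 - s) + f s) / 2.
have rpos : 0 < r.
  by have := f0 (a_ r0 + b_ r0 - s); rewrite /r; move: fs; lra.
have Frs : F r s by rewrite /F /= /r; lra.
have Fr : F r !=set0 by exists s.
have cE : a_ r0 + b_ r0 = a_ r + b_ r.
  have [rr|/ltW rr] := leP r0 r; first exact: center_cst.
  by rewrite (@center_cst r r0).
have : F r (a_ r0 + b_ r0 - s).
  have := Frs; rewrite {1 2}(FE (ltW rpos) Fr) cE /= !in_itv /= -/(a_ r) -/(b_ r) => /andP[h1 h2].
  by apply/andP; split; lra.
by rewrite /F /= /r; lra.
Qed.

End equality_case.

(** * The equality case in higher dimension *)

Section centroid.
Context {R : realType}.
Local Notation leb := (@lebesgue_measure R).
Local Notation vol := (@lebesgue_measure_rV R _).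

Lemma convex_setP n (A : set 'rV[R]_n) : convex_set A ->
  forall x y t, A x -> A y -> 0 <= t <= 1 -> A (t *: x + (1 - t) *: y).
Proof.
move=> cA x y t Ax Ay t01.
have it : Itv.spec (@Itv.num_sem R) (Itv.Real `[0%Z, 1%Z]) t.
  by rewrite /= /Itv.num_sem /= in_itv /= t01 andbT; apply: ger0_real; case/andP: t01.
have := cA x y (Itv.Def it); rewrite !inE; exact.
Qed.

Lemma bounded_integrable_rV n M N (A : set 'rV[R]_n) (g : 'rV[R]_n -> R) :
  0 < M -> measurable A -> bounded_by M A -> measurable_fun setT g ->
  (forall x, A x -> `|g x| <= N) -> (lebesgue_measure_rV n).-integrable A (EFin \o g).
Proof.
move=> M0 mA AM mg gN; apply: measurable_bounded_integrable => //.
- exact: vol_bounded_lty M0 mA AM.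
- exact: measurable_funTS.
- exists N; split; first exact: num_real.
  by move=> y Ny x Ax /=; rewrite (le_trans (gN x Ax)) // ltW.
Qed.

Lemma integral_fst n (A : set 'rV[R]_n.+1) (g : R -> \bar R) : measurable A ->
  measurable_fun setT g -> (forall t, 0 <= g t)%E ->
  (\int[lebesgue_measure_rV n.+1]_(x in A) g (x ord0 ord0) =
   \int[leb]_t (g t * vol (sec A t)))%E.
Proof.
move=> mA mg g0.
rewrite integral_mkcond /= /lebesgue_rV_step.
pose G x := ((fun x : 'rV[R]_n.+1 => g (x ord0 ord0)) \_ A) x.
have mG : measurable_fun setT G.
  rewrite /G; apply/(measurable_restrictT _ mA).
  apply: measurable_funTS; exact: measurableT_comp mg (measurable_coord_rV _).
have G0 x : (0 <= G x)%E by rewrite /G patchE; case: ifP.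
have -> : (\int[pushforward (leb \x lebesgue_measure_rV n) (rV_cons (n:=n))]_x G x =
    \int[(leb \x lebesgue_measure_rV n)%E]_p (G \o rV_cons (n:=n)) p)%E.
  pose mu : {measure set (measurableTypeR R * 'rV[R]_n) -> \bar R} :=
    (leb \x lebesgue_measure_rV n)%E.
  exact: (@ge0_integral_pushforward _ _ (measurableTypeR R * 'rV[R]_n)%type _ R
    _ (@measurable_rV_cons R n) mu setT G measurableT mG (fun x _ => G0 x)).
rewrite fubini_tonelli1 //; last 2 first.
- exact: measurableT_comp mG (@measurable_rV_cons R n).
- by move=> p; exact: G0.
apply: eq_integral => t _; rewrite /fubini_F /=.
transitivity (\int[lebesgue_measure_rV n]_(y in sec A t) g t)%E.
  rewrite [RHS]integral_mkcond; apply: eq_integral => y _.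
  by rewrite /G !patchE rV_cons_fst; congr (if _ then _ else _); apply/idP/idP; rewrite !inE.
by rewrite integral_cst //; exact: measurable_sec.
Qed.

Lemma dotv_lin n (w : 'rV[R]_n) (a b : R) x y :
  dotv w (a *: x + b *: y) = a * dotv w x + b * dotv w y.
Proof.
rewrite /dotv !mulr_sumr -big_split /=; apply: eq_bigr => i _.
by rewrite !mxE; ring.
Qed.

Lemma shearE n (w : 'rV[R]_n) t y : shear w (rV_cons (t, y)) = rV_cons (t + dotv w y, y).
Proof. by rewrite /shear rV_consK. Qed.

Lemma shear_lin n (w : 'rV[R]_n) (a b : R) x y :
  shear w (a *: x + b *: y) = a *: shear w x + b *: shear w y.
Proof.
have [s [x' ->]] := rV_consP x; have [t [y' ->]] := rV_consP y.
rewrite rV_cons_lin !shearE rV_cons_lin dotv_lin; congr rV_cons; congr pair; ring.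
Qed.

Lemma dotvNl n (w x : 'rV[R]_n) : dotv (- w) x = - dotv w x.
Proof. by rewrite /dotv -sumrN; apply: eq_bigr => i _; rewrite mxE mulNr. Qed.

Lemma shearNK n (w : 'rV[R]_n) : cancel (shear w) (shear (- w)).
Proof.
move=> x; have [s [x' ->]] := rV_consP x.
by rewrite !shearE dotvNl addrK.
Qed.

Lemma shearKN n (w : 'rV[R]_n) : cancel (shear (- w)) (shear w).
Proof. by have := shearNK (- w); rewrite opprK. Qed.

Lemma dotv_bound n (w x : 'rV[R]_n) e : (forall i, `|x ord0 i| <= e) ->
  `|dotv w x| <= (\sum_i `|w ord0 i|) * e.
Proof.
move=> xe; rewrite /dotv mulr_suml; apply: le_trans (ler_norm_sum _ _ _) _.
by apply: ler_sum => i _; rewrite normrM ler_wpM2l.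
Qed.

Lemma shear_bound n (w : 'rV[R]_n) (x : 'rV[R]_n.+1) e : 0 <= e ->
  (forall i, `|x ord0 i| <= e) ->
  forall i, `|shear w x ord0 i| <= (1 + \sum_i `|w ord0 i|) * e.
Proof.
have [s [y ->]] := rV_consP x => e0 xe i; rewrite shearE.
have S0 : 0 <= \sum_i `|w ord0 i| by apply: sumr_ge0.
case: (unliftP ord0 i) => [j ->|->].
  rewrite rV_cons_snd mulrDl mul1r; have := xe (lift ord0 j); rewrite rV_cons_snd => h.
  by rewrite (le_trans h) // lerDl mulr_ge0.
rewrite rV_cons_fst mulrDl mul1r (le_trans (ler_normD _ _)) // lerD //.
  by have := xe ord0; rewrite rV_cons_fst.
by apply: dotv_bound => j; have := xe (lift ord0 j); rewrite rV_cons_snd.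
Qed.

Lemma open_preimage_shear n (w : 'rV[R]_n) (A : set 'rV[R]_n.+1) :
  open A -> open (shear w @^-1` A).
Proof.
move=> /open_cubeP oA; apply/open_cubeP => x /oA [e e0 eA].
set S := \sum_i `|w ord0 i|.
have S0 : 0 <= S by apply: sumr_ge0.
have S1 : 0 < 2 * (1 + S) by rewrite mulr_gt0 // ltr_pwDl.
exists (e / (2 * (1 + S))); first by rewrite divr_gt0.
move=> y xy; apply: eA => i.
have := @shear_bound _ w (1 *: y + (- 1) *: x) (e / (2 * (1 + S))) _ _ i.
rewrite shear_lin !scale1r !scaleN1r !mxE -/S.
have -> : (1 + S) * (e / (2 * (1 + S))) = e / 2 by field; rewrite gt_eqF // ltr_pwDl.
move=> h; apply: le_lt_trans (h _ _) _; last by lra.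
  by rewrite divr_ge0 // ltW.
by move=> j; rewrite !mxE ltW.
Qed.

Lemma half_diff_preimage_shear n (w : 'rV[R]_n) (A : set 'rV[R]_n.+1) :
  half_diff (shear w @^-1` A) = shear w @^-1` half_diff A.
Proof.
have E (v : 'rV[R]_n) x y : shear v (2^-1 *: (x - y)) = 2^-1 *: (shear v x - shear v y).
  by have := shear_lin v 2^-1 (- 2^-1) x y; rewrite !scaleNr -!scalerBr.
apply/seteqP; split => [_ [x [y [Ax Ay ->]]]|z [x [y [Ax Ay Ez]]]].
  by exists (shear w x), (shear w y); split => //; rewrite E.
exists (shear (- w) x), (shear (- w) y); split; rewrite /= ?shearKN //.
by rewrite -E -Ez shearNK.
Qed.

Section symmetric_marginals.
Variables (n : nat) (M : R) (A : set 'rV[R]_n.+1).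
Hypotheses (M0 : 0 < M) (oA : open A) (AM : bounded_by M A).
Hypothesis midA : forall x y, A x -> A y -> A (2^-1 *: (x + y)).
Hypothesis le_vol : rvol (half_diff A) <= rvol A.

Let mA : measurable A := open_measurable_rV oA.

Lemma sec_symmetric : exists c, forall t, rvol (sec A (c - t)) = rvol (sec A t).
Proof.
have oK := open_half_diff oA.
have mK := open_measurable_rV oK.
have KM : bounded_by M (half_diff A) by exact: bounded_by_half_diff.
apply: (@midpoint_equality_symmetric R M (fun t => rvol (sec A t))
   (fun t => rvol (sec (half_diff A) t))).
- exact: measurable_rvol_sec.
- exact: measurable_rvol_sec.
- by move=> t; exact: rvol_ge0.
- by move=> t; exact: rvol_ge0.
- by move=> t; exact: (superlevel_sec_bounded AM (lexx 0)).
- by move=> r; exact: (open_superlevel_sec (r := r) M0 oA AM).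
- by move=> s t; exact: (rvol_sec_midpoint s t M0 mA AM midA).
- by move=> s t; exact: (rvol_sec_half_diff s t M0 oA AM).
- by rewrite -(rvolS M0 mA AM) ltry.
- by rewrite -(rvolS M0 mA AM) -(rvolS M0 mK KM) lee_fin.
Qed.

(** Both conclusions come from [sec_symmetric]. A nonempty open section has positive volume, so the
    section mirrored in [c / 2] is nonempty too; and the section volume is the density of the first
    coordinate, whose distribution is thus symmetric about [c / 2]. *)
Lemma fst_symmetric : exists c : R,
  (forall x, A x -> exists2 y, A y & y ord0 ord0 = c - x ord0 ord0) /\
  (forall g : R -> \bar R, measurable_fun setT g -> (forall t, 0 <= g t)%E ->
    (\int[lebesgue_measure_rV n.+1]_(x in A) g (x ord0 ord0) =
     \int[lebesgue_measure_rV n.+1]_(x in A) g (c - x ord0 ord0)%R)%E).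
Proof.
have [c fc] := sec_symmetric; exists c.
have volE t : vol (sec A t) = (rvol (sec A t))%:E.
  by rewrite (rvolK M0) //; [exact: measurable_sec|exact: bounded_by_sec].
split => [x Ax|g mg g0].
  have [s [x' xE]] := rV_consP x; rewrite xE rV_cons_fst.
  have : (0 < vol (sec A s))%E.
    by apply: (@open_vol_gt0 _ _ _ x'); [exact: open_sec|rewrite /sec /= -xE].
  rewrite volE -fc; have [->|/set0P[y Ay]] := eqVneq (sec A (c - s)) set0.
    by rewrite rvol0 ltxx.
  by exists (rV_cons (c - s, y)); rewrite ?rV_cons_fst.
have maff : measurable_fun setT (fun t : R => c - t).
  apply: (eq_measurable_fun (fun t : R => -1 * t + c)); last exact: measurable_affine.
  by move=> t _; rewrite mulN1r addrC.
rewrite integral_fst //.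
rewrite (@integral_fst _ _ (fun t => g (c - t))) //; last exact: measurableT_comp mg maff.
rewrite (@integral_affine R (-1) c) ?oppr_eq0 ?oner_eq0 //; last 2 first.
- by apply: emeasurable_funM => //; exact: measurable_fun_sec.
- by move=> t; rewrite mule_ge0.
rewrite normrN1 mul1e; apply: eq_integral => t _.
by rewrite mulN1r addrC volE fc -volE.
Qed.

End symmetric_marginals.

End centroid.

(** * Symmetry about the centroid *)

Section equality_symmetric.
Context {R : realType}.
Local Notation leb := (@lebesgue_measure R).

Lemma dotvB n (w x y : 'rV[R]_n) : dotv w (x - y) = dotv w x - dotv w y.
Proof. by have := dotv_lin w 1 (-1) x y; rewrite !scale1r scaleN1r mul1r mulN1r. Qed.

Lemma dotvZl n a (w x : 'rV[R]_n) : dotv (a *: w) x = a * dotv w x.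
Proof. by rewrite /dotv mulr_sumr; apply: eq_bigr => i _; rewrite mxE mulrA. Qed.

Lemma dotvC n (x y : 'rV[R]_n) : dotv x y = dotv y x.
Proof. by apply: eq_bigr => i _; rewrite mulrC. Qed.

Lemma dotvDl n (v w x : 'rV[R]_n) : dotv (v + w) x = dotv v x + dotv w x.
Proof. by rewrite /dotv -big_split /=; apply: eq_bigr => i _; rewrite mxE mulrDl. Qed.

Lemma dotvDr n (w x y : 'rV[R]_n) : dotv w (x + y) = dotv w x + dotv w y.
Proof. by rewrite ![dotv w _]dotvC dotvDl. Qed.

Lemma dotvZr n a (w x : 'rV[R]_n) : dotv w (a *: x) = a * dotv w x.
Proof. by rewrite ![dotv w _]dotvC dotvZl. Qed.

Lemma dotv_sqrD n (p q : 'rV[R]_n) t :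
  dotv (p + t *: q) (p + t *: q) = dotv p p + t * (2 * dotv p q + t * dotv q q).
Proof. by rewrite !(dotvDl, dotvDr, dotvZl, dotvZr) [dotv q p]dotvC; ring. Qed.

Lemma dotv_sqr_ge n (x : 'rV[R]_n) i : x ord0 i ^+ 2 <= dotv x x.
Proof.
rewrite /dotv (bigD1 i) //= -expr2 lerDl; apply: sumr_ge0 => j _.
by rewrite -expr2 sqr_ge0.
Qed.

Lemma dotv_rV_cons n t s (w y : 'rV[R]_n) :
  dotv (rV_cons (t, w)) (rV_cons (s, y)) = t * s + dotv w y.
Proof.
rewrite /dotv big_ord_recl !rV_cons_fst; congr (_ + _).
by apply: eq_bigr => i _; rewrite !rV_cons_snd.
Qed.

Lemma Rintegral_sum_rV n M (A : set 'rV[R]_n) (I : Type) (s : seq I) (f : I -> 'rV[R]_n -> R) :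
  0 < M -> measurable A -> bounded_by M A ->
  (forall i, (lebesgue_measure_rV n).-integrable A (EFin \o f i)) ->
  (lebesgue_measure_rV n).-integrable A (EFin \o (fun x => \sum_(i <- s) f i x)) /\
  \int[lebesgue_measure_rV n]_(x in A) (\sum_(i <- s) f i x) =
  \sum_(i <- s) \int[lebesgue_measure_rV n]_(x in A) f i x.
Proof.
move=> M0 mA AM fi; elim: s => [|a s [IH1 IH2]].
  under [X in EFin \o X]eq_fun do rewrite big_nil.
  rewrite big_nil; under eq_Rintegral do rewrite big_nil.
  rewrite Rintegral_cst // mul0r; split => //.
  by apply: (bounded_integrable_rV (N := 0) M0 mA AM) => // x _; rewrite normr0.
under [X in EFin \o X]eq_fun do rewrite big_cons.
under eq_Rintegral do rewrite big_cons.
rewrite big_cons RintegralD // IH2; split => //.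
exact: (integrableD mA (fi a) IH1).
Qed.

Section fiber.
Variables (n : nat) (M : R) (A : set 'rV[R]_n.+1).
Hypotheses (M0 : 0 < M) (oA : open A) (AM : bounded_by M A).
Hypothesis cA : forall x y t, A x -> A y -> 0 <= t <= 1 -> A (t *: x + (1 - t) *: y).
Hypothesis le_vol : rvol (half_diff A) <= rvol A.
Hypothesis vol_gt0 : 0 < rvol A.

Let mA : measurable A := open_measurable_rV oA.
Local Notation mu := (lebesgue_measure_rV n.+1).

Let midA x y : A x -> A y -> A (2^-1 *: (x + y)).
Proof.
move=> Ax Ay; have := cA (t := 2^-1) Ax Ay; rewrite scalerDr (_ : 1 - 2^-1 = 2^-1 :> R);
  last by lra.
by apply; apply/andP; split; lra.
Qed.

Definition centroid : 'rV[R]_n.+1 :=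
  \row_i ((\int[mu]_(x in A) x ord0 i) / rvol A).

Lemma Rintegral_dotv u : \int[mu]_(x in A) dotv u x = dotv u centroid * rvol A.
Proof.
have int i : mu.-integrable A (EFin \o (fun x : 'rV[R]_n.+1 => x ord0 i)).
  apply: (bounded_integrable_rV (N := M) M0 mA AM); first exact: measurable_coord_rV.
  by move=> x /AM.
have intu i : mu.-integrable A (EFin \o (fun x : 'rV[R]_n.+1 => u ord0 i * x ord0 i)).
  apply: (bounded_integrable_rV (N := `|u ord0 i| * M) M0 mA AM).
    by apply: measurable_funM => //; exact: measurable_coord_rV.
  by move=> x /AM xM; rewrite normrM ler_wpM2l.
have [_] := Rintegral_sum_rV (index_enum 'I_n.+1) M0 mA AM intu.
rewrite /dotv => ->; rewrite mulr_suml; apply: eq_bigr => i _.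
by rewrite RintegralZl // mxE -mulrA divfK ?gt_eqF.
Qed.

(** A shear turns the functional [u] into the first coordinate, preserves volumes and commutes with
    [half_diff], so [fst_symmetric] applies to the image [A']. Comparing the means of [dotv u x] and
    [c - dotv u x] over [A] shows that [c] is twice the value of [u] at the centroid. *)
Lemma centroid_fiber1 w y : A y ->
  exists2 x, A x & dotv (rV_cons (1, w)) x = dotv (rV_cons (1, w)) (2 *: centroid - y).
Proof.
move=> Ay; set u := rV_cons (1, w).
pose A' := shear (- w) @^-1` A.
have S0 : 0 <= \sum_i `|w ord0 i| by apply: sumr_ge0.
have M'0 : 0 < (1 + \sum_i `|w ord0 i|) * M by rewrite mulr_gt0 // ltr_pwDl.
have oA' : open A' by exact: open_preimage_shear.
have mA' := open_measurable_rV oA'.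
have A'M : bounded_by ((1 + \sum_i `|w ord0 i|) * M) A'.
  by move=> x A'x i; rewrite -(shearKN w x); apply: shear_bound; rewrite ?ltW // => j;
    exact: AM.
have vol' B : measurable B -> rvol (shear (- w) @^-1` B) = rvol B.
  by move=> mB; rewrite /rvol vol_shear.
have mid' x x' : A' x -> A' x' -> A' (2^-1 *: (x + x')).
  move=> A'x A'x'; rewrite /A' /= scalerDr shear_lin -scalerDr; exact: midA.
have le' : rvol (half_diff A') <= rvol A'.
  rewrite half_diff_preimage_shear !vol' //.
  exact: open_measurable_rV (open_half_diff oA).
have [c [Hc Hg]] := fst_symmetric M'0 oA' A'M mid' le'.
have uE x : dotv u x = shear w x ord0 ord0.
  have [t [x' ->]] := rV_consP x.
  by rewrite /u dotv_rV_cons shearE rV_cons_fst mul1r.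
have {}Hc x : A x -> exists2 x', A x' & dotv u x' = c - dotv u x.
  move=> Ax; have [|x' A'x' x'E] := Hc (shear w x); first by rewrite /A' /= shearNK.
  by exists (shear (- w) x') => //; rewrite !uE shearKN.
have push (g : R -> \bar R) : measurable_fun setT g -> (forall t, 0 <= g t)%E ->
    (\int[mu]_(x in A') g (x ord0 ord0) = \int[mu]_(x in A) g (dotv u x))%E.
  move=> mg g0.
  have mgc : measurable_fun setT (fun x : 'rV[R]_n.+1 => g (x ord0 ord0)).
    exact: measurableT_comp mg (measurable_coord_rV _).
  transitivity (\int[pushforward mu (shear w)]_(x in A') g (x ord0 ord0))%E.
    pose nu0 : {measure set 'rV[R]_n.+1 -> \bar R} := pushforward mu (shear w).
    pose nu := nu0 (measurable_shear w).
    apply: (@eq_measure_integral _ _ _ _ nu) => B mB _.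
    by rewrite /nu /nu0 /= /pushforward vol_shear.
  rewrite (ge0_integral_pushforward (measurable_shear w)) //; last exact: measurable_funTS.
  have -> : shear w @^-1` A' = A by apply/seteqP; split => x; rewrite /A' /= shearNK.
  by apply: eq_integral => x _ /=; rewrite uE.
(* The symmetry of the distribution is stated for nonnegative integrands. Adding [N] makes both
   [dotv u x] and [c - dotv u x] nonnegative on [A], so the maximum in [g] changes nothing there. *)
pose N := (\sum_i `|u ord0 i|) * M + `|c|.
have uN x : A x -> `|dotv u x| <= (\sum_i `|u ord0 i|) * M.
  by move=> Ax; apply: dotv_bound => i; exact: AM.
pose g t : \bar R := (Num.max (t + N) 0)%:E.
have mg : measurable_fun setT g.
  apply/measurable_EFinP; apply: measurable_maxr => //.
  exact: measurable_funD.
have g0 t : (0 <= g t)%E by rewrite lee_fin le_max lexx orbT.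
have mc : measurable_fun setT (fun t : R => c - t).
  by apply: measurable_funB.
have := Hg g mg g0; rewrite push // (push (fun t => g (c - t))) //;
  last exact: measurableT_comp mg mc.
have E1 : (\int[mu]_(x in A) g (dotv u x) = \int[mu]_(x in A) (dotv u x + N)%:E)%E.
  apply: eq_integral => x; rewrite inE => /uN; rewrite /g ler_norml => /andP[h _].
  congr EFin; apply/max_idPl; rewrite /N; have := normr_ge0 c; lra.
have E2 : (\int[mu]_(x in A) g (c - dotv u x)%R = \int[mu]_(x in A) (c - dotv u x + N)%:E)%E.
  apply: eq_integral => x; rewrite inE => /uN; rewrite /g ler_norml => /andP[_ h].
  congr EFin; apply/max_idPl; rewrite /N; have := ler_norm (- c); rewrite normrN; lra.
have intcst (k : R) : mu.-integrable A (EFin \o (fun=> k)).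
  exact: (bounded_integrable_rV (N := `|k|) M0 mA AM).
have intu : mu.-integrable A (EFin \o dotv u).
  exact: (bounded_integrable_rV M0 mA AM (measurable_dotv u) uN).
rewrite E1 E2 => /(congr1 fine).
rewrite -[LHS]/(\int[mu]_(x in A) (dotv u x + N)) -[RHS]/(\int[mu]_(x in A) (c - dotv u x + N)).
have intcu : mu.-integrable A (EFin \o (fun x => c - dotv u x)).
  exact: (integrableB mA (intcst c) intu).
rewrite RintegralD // (RintegralD (f1 := fun x => c - dotv u x)) //.
rewrite RintegralB // Rintegral_dotv !Rintegral_cst // -/(rvol A) => E.
have {}E : 2 * dotv u centroid = c.
  by apply: (mulIf (lt0r_neq0 vol_gt0)); lra.
have [x Ax xE] := Hc y Ay; exists x => //; rewrite xE dotvB -E; congr (_ - _).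
by have := dotv_lin u 2 0 centroid centroid; rewrite scale0r addr0 mul0r addr0.
Qed.

Lemma centroid_fiber (u y : 'rV[R]_n.+1) : u ord0 ord0 != 0 -> A y ->
  exists2 x, A x & dotv u x = dotv u (2 *: centroid - y).
Proof.
move=> u0 Ay; have [t [w uE]] := rV_consP u.
have t0 : t != 0 by move: u0; rewrite uE rV_cons_fst.
have uE' : u = t *: rV_cons (1, t^-1 *: w).
  by rewrite uE rV_consZ mulr1 scalerA divff ?scale1r.
have [x Ax xE] := centroid_fiber1 (t^-1 *: w) Ay.
by exists x => //; rewrite uE' !dotvZl xE.
Qed.

(* The functional is [p = x0 - z] for an almost nearest point [x0] of [A], perturbed so that its
   first coordinate does not vanish. *)
Lemma separation (z : 'rV[R]_n.+1) r : 0 < r -> A !=set0 -> (forall x, A x ->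
  r <= dotv (x - z) (x - z)) ->
  exists2 u : 'rV[R]_n.+1, u ord0 ord0 != 0 & forall x, A x -> dotv u x != dotv u z.
Proof.
move=> r0 [a0 Aa0] far.
pose S := [set dotv (x - z) (x - z) | x in A].
have iS : has_inf S.
  split; first by exists (dotv (a0 - z) (a0 - z)), a0.
  by exists r => _ [x Ax <-]; exact: far.
pose I := inf S.
have I0 : 0 < I by apply: lt_le_trans r0 _; apply: lb_le_inf; [case: iS|move=> _ [x Ax <-];
  exact: far].
have Ile x : A x -> I <= dotv (x - z) (x - z).
  by move=> Ax; apply: ge_inf; [case: iS|exists x].
pose D := \sum_(i < n.+1) (2 * M) * (2 * M).
have D0 : 0 <= D by apply: sumr_ge0 => i _; rewrite mulr_ge0 // mulr_ge0 // ltW.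
have AD x y : A x -> A y -> dotv (x - y) (x - y) <= D.
  move=> /AM xM /AM yM; apply: ler_sum => i _; rewrite !mxE -expr2 -real_normK ?num_real //
    expr2.
  have : `|x ord0 i - y ord0 i| <= 2 * M.
    by apply: le_trans (ler_normB _ _) _; have := xM i; have := yM i; lra.
  by move=> h; apply: ler_pM.
(* A step from [x0] towards [x] cannot bring the squared distance to [z] below [I]. Since [D] bounds
   the squared diameter of [A], this [th] makes the quadratic term at most [I / 4] per unit of [th];
   the accuracy [th * I / 4] of [x0] costs another [I / 4]. *)
pose th := Num.min 1 (I / (4 * (D + 1))).
have D1 : 0 < 4 * (D + 1) by rewrite mulr_gt0 // ltr_wpDl.
have th0 : 0 < th by rewrite lt_min ltr01 divr_gt0.
have th1 : th <= 1 by rewrite ge_min lexx.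
have thD : th * D <= I / 4.
  have : th <= I / (4 * (D + 1)) by rewrite ge_min lexx orbT.
  rewrite ler_pdivlMr // => h; have : 0 <= th by exact: ltW. nra.
have e0 : 0 < th * I / 4 by rewrite divr_gt0 // mulr_gt0.
have [_ [x0 Ax0 <-] hx0] := inf_adherent e0 iS.
pose p := x0 - z.
have sep x : A x -> I / 2 <= dotv p (x - z).
  move=> Ax; have := Ile _ (cA (t := th) Ax Ax0 _); rewrite ltW // th1 => /(_ isT).
  have -> : th *: x + (1 - th) *: x0 - z = p + th *: (x - x0).
    by rewrite /p scalerBl scale1r scalerBr; apply/rowP => i; rewrite !mxE; ring.
  have -> : x - z = (x - x0) + p by rewrite /p addrA subrK.
  have := AD _ _ Ax Ax0; set dx := x - x0.
  rewrite dotv_sqrD (dotvDr p dx p).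
  have := Ile _ Ax0; move: hx0; rewrite -/I -/p.
  set pp := dotv p p; set q := dotv p dx; set v := dotv dx _ => h1 h2 h3 h4.
  have h5 : th * (th * v) <= th * (I / 4).
    rewrite ler_pM2l //; apply: le_trans thD; rewrite ler_pM2l //.
  have : 0 <= th * (2 * q + I / 2) by lra.
  by rewrite pmulr_rge0 //; lra.
(* On [A] the first coordinate of [x - z] is at least [- D2], so the perturbation [eta] lowers the
   functional by at most [I / 4], less than the gap [I / 2] in [sep]. *)
pose D2 := M + `|z ord0 ord0| + 1.
have D20 : 0 < D2 by rewrite ltr_wpDl // addr_ge0 // ltW.
pose eta := if p ord0 ord0 == 0 then I / (4 * D2) else 0.
have eta0 : 0 <= eta by rewrite /eta; case: ifP => // _; rewrite divr_ge0 ?mulr_ge0 ?ltW.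
have etaD : eta * D2 <= I / 4.
  rewrite /eta; case: ifP => _; last by rewrite mul0r divr_ge0 // ltW.
  by rewrite invfM mulrA divfK // gt_eqF.
exists (p + rV_cons (eta, 0)) => [|x Ax].
  rewrite mxE rV_cons_fst /eta; case: ifPn => [/eqP->|]; last by rewrite addr0.
  by rewrite add0r gt_eqF // divr_gt0 // mulr_gt0.
rewrite -subr_eq0 -dotvB dotvDl gt_eqF //.
have -> : dotv (rV_cons (eta, 0)) (x - z) = eta * (x ord0 ord0 - z ord0 ord0).
  have [t [x' ->]] := rV_consP x; have [s [z' ->]] := rV_consP z.
  rewrite rV_consN rV_consD dotv_rV_cons !rV_cons_fst.
  by rewrite (_ : dotv 0 _ = 0) ?addr0 //; apply: big1 => i _; rewrite mxE mul0r.
have := sep x Ax.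
have : - D2 <= x ord0 ord0 - z ord0 ord0.
  have := AM Ax ord0; rewrite ler_norml => /andP[h _]; have := ler_norm (z ord0 ord0).
  by rewrite /D2; lra.
by move=> h; have : eta * - D2 <= eta * (x ord0 ord0 - z ord0 ord0); [rewrite ler_wpM2l|lra].
Qed.

(** Otherwise [separation] provides a functional that takes its value at the reflected point nowhere
    on [A], contrary to [centroid_fiber]. *)
Lemma reflection_adherent y e : A y -> 0 < e ->
  exists2 x, A x & cube (2 *: centroid - y) e x.
Proof.
move=> Ay e0; apply: contrapT => nx.
have [|||u u0 uz] := @separation (2 *: centroid - y) (e ^+ 2).
- by rewrite exprn_gt0.
- by exists y.
- move=> x Ax; apply: contrapT => /negP; rewrite -ltNge => lt_e; apply: nx; exists x => // i.
  apply: ltr_sqr_ge0; [exact: ltW|rewrite real_normK ?num_real //].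
  apply: le_lt_trans lt_e; have := dotv_sqr_ge (x - (2 *: centroid - y)) i.
  by rewrite !mxE.
have [x Ax xE] := centroid_fiber u0 Ay.
by have := uz x Ax; rewrite xE eqxx.
Qed.

(** So far the reflection [z] of [y] is only adherent to [A]. Pushing [y] slightly away from [z]
    gives [y'] in [A], whose reflection [w] lies beyond [z]; then [z] lies on a segment between a
    point [w'] of [A] near [w] and a point [a] of [A] near [y]. *)
Theorem half_diff_equality_symmetric : symmetric_wrt A centroid.
Proof.
move=> y Ay; set z := 2 *: centroid - y.
have /open_cubeP/(_ y Ay)[e e0 eA] := oA.
pose S := \sum_i `|(z - y) ord0 i|.
have S0 : 0 <= S by apply: sumr_ge0.
have zyS i : `|(z - y) ord0 i| <= S.
  by rewrite /S (bigD1 i) //= lerDl; apply: sumr_ge0.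
pose de := e / (2 * (S + 1)).
have S1 : 0 < 2 * (S + 1) by rewrite mulr_gt0 // ltr_wpDl.
have de0 : 0 < de by rewrite divr_gt0.
have deS : de * S < e.
  rewrite /de mulrAC ltr_pdivrMr // ltr_pM2l //; lra.
pose y' := y - de *: (z - y).
have Ay' : A y'.
  apply: eA => i; have -> : y' ord0 i - y ord0 i = - (de * (z - y) ord0 i).
    by rewrite /y' !mxE; ring.
  rewrite normrN normrM (gtr0_norm de0); apply: le_lt_trans deS.
  by rewrite ler_pM2l.
have [w' Aw' hw] := reflection_adherent Ay' (mulr_gt0 de0 e0).
pose w := 2 *: centroid - y'.
have wE : w = z + de *: (z - y) by rewrite /w /y' /z opprB addrCA addrC.
(* The unique point for which the weights [(1 + de)^-1] and [1 - (1 + de)^-1] on [w'] and [a] give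
   exactly [z]. The error [w' - w] is magnified by [de^-1], which is why it was taken below
   [de * e]. *)
pose a := y - de^-1 *: (w' - w).
have Aa : A a.
  apply: eA => i; have -> : a ord0 i - y ord0 i = - (de^-1 * (w' ord0 i - w ord0 i)).
    by rewrite /a !mxE; ring.
  rewrite normrN normrM normfV (gtr0_norm de0) mulrC ltr_pdivrMr // mulrC.
  exact: hw.
have de1 : 0 < 1 + de by rewrite addr_gt0.
have := cA (t := (1 + de)^-1) Aw' Aa.
have -> : (1 + de)^-1 *: w' + (1 - (1 + de)^-1) *: a = z.
  apply/rowP => i; rewrite /a wE !mxE; field; rewrite !gt_eqF //.
by apply; rewrite invr_ge0 ltW //= invf_le1 // lerDl ltW.
Qed.

End fiber.

End equality_symmetric.

(** * Bounded complex functions and orthonormal expansions *)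

Section complex_integral.
Context {R : realType} (d : nat).
Implicit Types (f g u e : 'rV[R]_d -> R[i]) (z w : R[i]).
Local Notation mu := (@lebesgue_measure_rV R d).

Lemma normsqCM z w : normsqC (z * w) = normsqC z * normsqC w.
Proof. by case: z w => [a b] [c k]; rewrite /normsqC /=; ring. Qed.

Lemma normsqC_conj z : normsqC z^* = normsqC z.
Proof. by case: z => a b; rewrite /normsqC /= sqrrN. Qed.

Lemma normsqC_ge0 z : 0 <= normsqC z.
Proof. by rewrite addr_ge0 // sqr_ge0. Qed.

Lemma normsqC_sub z w c :
  normsqC (z - c * w) = normsqC z - 2 * complex.Re (c^* * (z * w^*)) + normsqC c * normsqC w.
Proof. by case: z w c => [a b] [a' b'] [k l]; rewrite /normsqC /=; ring. Qed.

Lemma normsqC_parallelogram z w :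
  normsqC (z + w) - normsqC (z - w) = 4 * complex.Re (z * w^*).
Proof. by case: z w => [a b] [a' b']; rewrite /normsqC /=; ring. Qed.

(** Bounded Borel functions on the whole space: closed under the algebraic operations in use, and
    integrable, as are their squared moduli, over every bounded measurable set. *)
Definition bmC f := [/\ measurable_fun [set: 'rV[R]_d] (fun x => complex.Re (f x)),
  measurable_fun [set: 'rV[R]_d] (fun x => complex.Im (f x)) &
  exists N : R, forall x, `|complex.Re (f x)| <= N /\ `|complex.Im (f x)| <= N].

Lemma bmC_cst z : bmC (fun=> z).
Proof.
split; [exact: measurable_cst|exact: measurable_cst|].
exists (`|complex.Re z| + `|complex.Im z|) => _.
by split; rewrite ?lerDl ?lerDr.
Qed.

Lemma bmCD f g : bmC f -> bmC g -> bmC (fun x => f x + g x).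
Proof.
move=> [f1 f2 [N fN]] [g1 g2 [P gP]].
have RD x : complex.Re (f x + g x) = complex.Re (f x) + complex.Re (g x)
  by case: (f x) (g x) => ? ? [].
have ID x : complex.Im (f x + g x) = complex.Im (f x) + complex.Im (g x)
  by case: (f x) (g x) => ? ? [].
split.
- by under eq_fun do rewrite RD; exact: measurable_funD.
- by under eq_fun do rewrite ID; exact: measurable_funD.
- exists (N + P) => x; have [? ?] := fN x; have [? ?] := gP x.
  by rewrite RD ID; split; rewrite (le_trans (ler_normD _ _)) // lerD.
Qed.

Lemma bmCM f g : bmC f -> bmC g -> bmC (fun x => f x * g x).
Proof.
move=> [f1 f2 [N fN]] [g1 g2 [P gP]].
have RM x : complex.Re (f x * g x) =
  complex.Re (f x) * complex.Re (g x) - complex.Im (f x) * complex.Im (g x).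
  by case: (f x) (g x) => ? ? [].
have IM x : complex.Im (f x * g x) =
  complex.Re (f x) * complex.Im (g x) + complex.Im (f x) * complex.Re (g x).
  by case: (f x) (g x) => ? ? [].
split.
- by under eq_fun do rewrite RM; apply: measurable_funB; exact: measurable_funM.
- by under eq_fun do rewrite IM; apply: measurable_funD; exact: measurable_funM.
- exists (N * P + N * P) => x; have [? ?] := fN x; have [? ?] := gP x.
  rewrite RM IM; split.
    by rewrite (le_trans (ler_normB _ _)) // !normrM lerD // ler_pM.
  by rewrite (le_trans (ler_normD _ _)) // !normrM lerD // ler_pM.
Qed.

Lemma bmC_conj f : bmC f -> bmC (fun x => (f x)^*).
Proof.
move=> [f1 f2 [N fN]]; have IC x : complex.Im (f x)^* = - complex.Im (f x) by case: (f x).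
have RC x : complex.Re (f x)^* = complex.Re (f x) by case: (f x).
split; [by under eq_fun do rewrite RC|by under eq_fun do rewrite IC; exact: measurable_funN|].
by exists N => x; rewrite RC IC normrN.
Qed.

Lemma bmCZ z f : bmC f -> bmC (fun x => z * f x).
Proof. by move=> bf; apply: bmCM => //; exact: bmC_cst. Qed.

Lemma bmCB f g : bmC f -> bmC g -> bmC (fun x => f x - g x).
Proof.
move=> bf bg; have -> : (fun x => f x - g x) = (fun x => f x + (-1) * g x).
  by apply/funext => x; rewrite mulN1r.
by apply: bmCD => //; exact: bmCZ.
Qed.

Lemma bmC_sum (I : eqType) (s : seq I) (F : I -> 'rV[R]_d -> R[i]) :
  {in s, forall i, bmC (F i)} -> bmC (fun x => \sum_(i <- s) F i x).
Proof.
elim: s => [|i s IH] bF.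
  by under eq_fun do rewrite big_nil; exact: bmC_cst.
under eq_fun do rewrite big_cons; apply: bmCD; first by apply: bF; rewrite inE eqxx.
by apply: IH => j js; apply: bF; rewrite inE js orbT.
Qed.

Lemma bmC_e_ (lambda : 'rV[R]_d) : bmC (e_ lambda).
Proof.
have mt : measurable_fun setT (fun x : 'rV[R]_d => 2 * pi * dotv lambda x).
  by apply: measurable_funM => //; exact: measurable_dotv.
split => /=.
- apply: measurableT_comp mt; apply: continuous_measurable_fun; exact: continuous_cos.
- apply: measurableT_comp mt; apply: continuous_measurable_fun; exact: continuous_sin.
- by exists 1 => x; rewrite !ler_norml cos_geN1 cos_le1 sin_geN1 sin_le1.
Qed.

Lemma bmC_indic (T : set 'rV[R]_d) : measurable T -> bmC (fun x => Complex (\1_T x) 0).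
Proof.
move=> mT; split => /=; [exact: measurable_indic|exact: measurable_cst|].
by exists 1 => x; rewrite normr0 indicE; case: (_ \in _); rewrite ?normr1 ?normr0.
Qed.

Lemma normsqC_e_ (lambda : 'rV[R]_d) x : normsqC (e_ lambda x) = 1.
Proof. by rewrite /normsqC /= cos2Dsin2. Qed.

Lemma e_D (lambda : 'rV[R]_d) x y : e_ lambda (x + y) = e_ lambda x * e_ lambda y.
Proof.
rewrite /e_ dotvDr mulrDr /expi cosD sinD.
by apply/eqP; rewrite eq_complex /= eqxx /= addrC.
Qed.

Section domain.
Variables (M : R) (D : set 'rV[R]_d).
Hypotheses (M0 : 0 < M) (mD : measurable D) (DM : bounded_by M D).

Lemma bmC_integrable f : bmC f -> mu.-integrable D (EFin \o (fun x => complex.Re (f x))) /\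
  mu.-integrable D (EFin \o (fun x => complex.Im (f x))).
Proof.
move=> [f1 f2 [N fN]]; split; apply: (bounded_integrable_rV (N := N) M0 mD DM) => // x _.
  exact: (fN x).1.
exact: (fN x).2.
Qed.

Lemma cintegralD f g : bmC f -> bmC g ->
  cintegral D (fun x => f x + g x) = cintegral D f + cintegral D g.
Proof.
move=> /bmC_integrable[f1 f2] /bmC_integrable[g1 g2]; rewrite /cintegral.
apply/eqP; rewrite eq_complex /=; apply/andP; split; apply/eqP.
  by rewrite -RintegralD //; apply: eq_Rintegral => x _; case: (f x) (g x) => ? ? [].
by rewrite -RintegralD //; apply: eq_Rintegral => x _; case: (f x) (g x) => ? ? [].
Qed.

Lemma cintegralZ z f : bmC f -> cintegral D (fun x => z * f x) = z * cintegral D f.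
Proof.
move=> /bmC_integrable[f1 f2]; rewrite /cintegral.
have int (a : R) (h : 'rV[R]_d -> R) : mu.-integrable D (EFin \o h) ->
    mu.-integrable D (EFin \o (fun x => a * h x)).
  by move=> ih; exact: (integrableZl mD a ih).
case: z => a b; apply/eqP; rewrite eq_complex /=; apply/andP; split; apply/eqP.
  rewrite -!RintegralZl // -RintegralB //; do ?exact: int.
  by apply: eq_Rintegral => x _; case: (f x).
rewrite -!RintegralZl // -RintegralD //; do ?exact: int.
by apply: eq_Rintegral => x _; case: (f x).
Qed.

Lemma cintegralB f g : bmC f -> bmC g ->
  cintegral D (fun x => f x - g x) = cintegral D f - cintegral D g.
Proof.
move=> bf bg; rewrite -mulN1r -cintegralZ // -cintegralD //; last exact: bmCZ.
by congr cintegral; apply/funext => x; rewrite mulN1r.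
Qed.

Definition normsq2 f : R := \int[mu]_(x in D) normsqC (f x).

Lemma normsq2E f : normsq2 f = complex.Re (inner_prod D f f).
Proof.
by apply: eq_Rintegral => x _; case: (f x) => a b; rewrite /normsqC /=; ring.
Qed.

Lemma normsq_integrable f : bmC f -> mu.-integrable D (EFin \o (fun x => normsqC (f x))).
Proof.
move=> bf; have [h _] := bmC_integrable (bmCM bf (bmC_conj bf)).
apply: eq_integrable h => // x _ /=; congr EFin.
by case: (f x) => a b; rewrite /normsqC /=; ring.
Qed.

Lemma normsq2_ge0 f : 0 <= normsq2 f.
Proof. by apply: Rintegral_ge0 => x _; exact: normsqC_ge0. Qed.

Lemma L2norm_sqE f : bmC f -> L2norm_sq D f = (normsq2 f)%:E.
Proof.
by move=> /normsq_integrable bf; rewrite /normsq2 /Rintegral fineK //;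
  exact: integrable_fin_num.
Qed.

Lemma in_L2_bmC f : bmC f -> in_L2 D f.
Proof.
move=> bf; split; [by apply: measurable_funTS; case: bf|by apply: measurable_funTS; case: bf|].
by rewrite L2norm_sqE // ltry.
Qed.

Lemma normsq2_sub f e z : bmC f -> bmC e ->
  normsq2 (fun x => f x - z * e x) =
  normsq2 f - 2 * complex.Re (z^* * inner_prod D f e) + normsqC z * normsq2 e.
Proof.
move=> bf be; have bfe := bmCM bf (bmC_conj be).
rewrite /inner_prod -cintegralZ // /normsq2.
have [h1 _] := bmC_integrable (bmCZ z^* bfe).
have h2 := normsq_integrable bf; have h3 := normsq_integrable be.
have h1' : mu.-integrable D (EFin \o (fun x => 2 * complex.Re (z^* * (f x * (e x)^*)))).
  exact: (integrableZl mD 2 h1).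
have h3' : mu.-integrable D (EFin \o (fun x => normsqC z * normsqC (e x))).
  exact: (integrableZl mD (normsqC z) h3).
rewrite /cintegral /= -RintegralZl // -RintegralZl // -RintegralB // -RintegralD //;
  last first.
  exact: (integrableB mD h2 h1').
by apply: eq_Rintegral => x _; rewrite normsqC_sub.
Qed.

Lemma inner_prodB f g e : bmC f -> bmC g -> bmC e ->
  inner_prod D (fun x => f x - g x) e = inner_prod D f e - inner_prod D g e.
Proof.
move=> bf bg be; rewrite /inner_prod -cintegralB; do ?by apply: bmCM => //; exact: bmC_conj.
by congr cintegral; apply/funext => x; rewrite mulrBl.
Qed.

Lemma inner_prodD f g e : bmC f -> bmC g -> bmC e ->
  inner_prod D (fun x => f x + g x) e = inner_prod D f e + inner_prod D g e.
Proof.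
move=> bf bg be; rewrite /inner_prod -cintegralD; do ?by apply: bmCM => //; exact: bmC_conj.
by congr cintegral; apply/funext => x; rewrite mulrDl.
Qed.

Lemma inner_prodZ z f e : bmC f -> bmC e ->
  inner_prod D (fun x => z * f x) e = z * inner_prod D f e.
Proof.
move=> bf be; rewrite /inner_prod -cintegralZ; last by apply: bmCM => //; exact: bmC_conj.
by congr cintegral; apply/funext => x; rewrite mulrA.
Qed.

End domain.
End complex_integral.

(** * Bessel's inequality and approximation by finite sums *)

Section orthonormal_expansion.
Context {R : realType} (d : nat) (M : R) (D : set 'rV[R]_d).
Local Notation mu := (@lebesgue_measure_rV R d).
Hypotheses (M0 : 0 < M) (mD : measurable D) (DM : bounded_by M D).
Variable E : set ('rV[R]_d -> R[i]).
Hypothesis bE : forall u, E u -> bmC u.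
Hypothesis ortE : orthonormal_system D E.

(** Complete the square one term at a time: by orthogonality, subtracting [c u * u] leaves the
    coefficients along the rest of [s] unchanged. The last sum vanishes for the Fourier
    coefficients, which gives Bessel's inequality, and is nonnegative in general, which gives best
    approximation. *)
Lemma normsq2_sub_sum (s : seq ('rV[R]_d -> R[i])) (c : ('rV[R]_d -> R[i]) -> R[i]) h :
  uniq s -> {in s, forall u, E u} -> bmC h ->
  normsq2 D (fun x => h x - \sum_(u <- s) c u * u x) =
  normsq2 D h - \sum_(u <- s) normsqC (inner_prod D h u) +
  \sum_(u <- s) normsqC (c u - inner_prod D h u).
Proof.
elim: s h => [|u s IH] h us sE bh.
  rewrite !big_nil subr0 addr0; apply: eq_Rintegral => x _.
  by rewrite big_nil subr0.
have Eu : E u by apply: sE; rewrite inE eqxx.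
have sE' : {in s, forall v, E v} by move=> v vs; apply: sE; rewrite inE vs orbT.
have bu := bE Eu.
have bg : bmC (fun x => h x - c u * u x) by apply: bmCB => //; exact: bmCZ.
have [_ nE oE] := ortE.
move: us; rewrite cons_uniq => /andP[us unis].
have ipg v : v \in s -> inner_prod D (fun x => h x - c u * u x) v = inner_prod D h v.
  move=> vs; have bv := bE (sE' v vs).
  rewrite (inner_prodB M0 mD DM) //; last exact: bmCZ.
  have uv0 : inner_prod D u v = 0.
    by apply: oE => //; [exact: sE'|move=> uv; move: us; rewrite uv vs].
  by rewrite (inner_prodZ M0 mD DM) // uv0 mulr0 subr0.
have nu : normsq2 D u = 1 by rewrite normsq2E nE.
have -> : normsq2 D (fun x => h x - \sum_(v <- u :: s) c v * v x) =
  normsq2 D (fun x => h x - c u * u x - \sum_(v <- s) c v * v x).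
  by apply: eq_Rintegral => x _; rewrite big_cons opprD addrA.
rewrite (IH _ unis sE' bg) !big_cons (normsq2_sub M0 mD DM) // nu mulr1.
rewrite (eq_big_seq (fun v => normsqC (inner_prod D h v))); last by move=> v /ipg ->.
rewrite [X in _ + X = _](eq_big_seq (fun v => normsqC (c v - inner_prod D h v))); last first.
  by move=> v /ipg ->.
set S := \sum_(v <- s) _; set T := \sum_(v <- s) _; set N := normsq2 D h.
by case: (inner_prod D h u) (c u) => a b [k l]; rewrite /normsqC /=; ring.
Qed.

Lemma bessel (s : seq ('rV[R]_d -> R[i])) h :
  uniq s -> {in s, forall u, E u} -> bmC h ->
  \sum_(u <- s) normsqC (inner_prod D h u) <= normsq2 D h.
Proof.
move=> us sE bh; rewrite -subr_ge0.
have := normsq2_sub_sum (inner_prod D h) us sE bh.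
rewrite [X in _ + X](_ : _ = 0) ?addr0 => [<-|]; first exact: normsq2_ge0.
by apply: big1 => u _; rewrite subrr /normsqC /= expr0n addr0.
Qed.

(** The defect is controlled for every finite family containing [l], so that a single family can
    serve several functions at once. *)
Lemma total_approx h del : total_system D E -> bmC h -> 0 < del ->
  exists2 l : seq ('rV[R]_d -> R[i]), {in l, forall u, E u} &
  forall s, uniq s -> {in s, forall u, E u} -> {subset l <= s} ->
  normsq2 D h - \sum_(u <- s) normsqC (inner_prod D h u) <= del.
Proof.
move=> tE bh d0; have sd : 0 < Num.sqrt del by rewrite sqrtr_gt0.
have [n [u [c [uE]]]] := tE h (in_L2_bmC M0 mD DM bh) _ sd.
have bsum : bmC (fun x => h x - \sum_(k < n) c k * u k x).
  by apply: bmCB => //; apply: bmC_sum => k _; apply: bmCZ; exact: bE.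
rewrite (L2norm_sqE M0 mD DM bsum) lte_fin sqr_sqrtr ?ltW // => lt_del.
exists [seq u k | k <- enum 'I_n] => [v /mapP[k _ ->] //|s us sE ls].
apply: ltW; apply: le_lt_trans lt_del.
(* The functions [u k] may repeat, whereas [s] has no duplicates: coefficients of equal functions
   are added up, and those of functions that do not occur are 0. *)
pose c' v := \sum_(k < n | u k == v) c k.
have -> : normsq2 D (fun x => h x - \sum_(k < n) c k * u k x) =
    normsq2 D (fun x => h x - \sum_(v <- s) c' v * v x).
  apply: eq_Rintegral => x _; congr (normsqC (_ - _)).
  under [RHS]eq_bigr do rewrite /c' mulr_suml.
  rewrite (exchange_big_dep xpredT) //=; apply: eq_bigr => k _.
  rewrite (eq_bigl (fun v => v == u k)); last by move=> v; rewrite eq_sym.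
  have uks : u k \in s by apply: ls; apply: map_f; exact: mem_enum.
  rewrite big_mkcond (bigD1_seq (u k)) //= eqxx big1 ?addr0 // => v vu.
  by rewrite (negbTE vu).
rewrite normsq2_sub_sum // lerDl; apply: sumr_ge0 => v _; exact: normsqC_ge0.
Qed.

End orthonormal_expansion.

(** * Fourier coefficients of translated pieces *)

Section translated_pieces.
Context {R : realType} (d : nat).
Local Notation mu := (@lebesgue_measure_rV R d).

Lemma vol_translate (v : 'rV[R]_d) (A : set 'rV[R]_d) : measurable A ->
  mu [set x | A (x - v)] = mu A.
Proof.
move=> mA; rewrite -[RHS](@vol_affine _ _ 1 (- v)) ?normr1 //.
by congr (mu _); apply/seteqP; split => x /=; rewrite scale1r.
Qed.

Lemma measurable_translate (v : 'rV[R]_d) : measurable_fun setT (fun x : 'rV[R]_d => x - v).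
Proof.
apply: (eq_measurable_fun (fun x : 'rV[R]_d => 1 *: x + (- v))) => [x _|].
  by rewrite scale1r.
exact: measurable_rV_affine.
Qed.

Lemma Rintegral_translate (v : 'rV[R]_d) (M N : R) (Q : set 'rV[R]_d) (g : 'rV[R]_d -> R) :
  0 < M -> measurable Q -> bounded_by M Q -> measurable_fun setT g ->
    (forall x, `|g x| <= N) ->
  \int[mu]_(x in [set x | Q (x - v)]) g x = \int[mu]_(x in Q) g (x + v).
Proof.
move=> M0 mQ QM mg gN; congr fine.
have mt := measurable_translate v.
have mQv : measurable [set x | Q (x - v)] by exact: measurable_preimage mt mQ.
pose nu0 : {measure set 'rV[R]_d -> \bar R} := pushforward mu (fun x => x - v).
pose nu := nu0 mt.
have mg' : measurable_fun setT (fun x : 'rV[R]_d => g (x + v)).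
  by apply: measurableT_comp mg _; have := measurable_translate (- v); rewrite opprK.
have QvM : bounded_by (M + \sum_i `|v ord0 i|) [set x | Q (x - v)].
  move=> x /QM xM i; have := xM i; rewrite !mxE => h.
  rewrite -(subrK (v ord0 i) (x ord0 i)) (le_trans (ler_normD _ _)) // lerD //.
  by rewrite (bigD1 i) //= lerDl sumr_ge0.
transitivity (\int[nu]_(x in Q) (g (x + v))%:E)%E; last first.
  by apply: eq_measure_integral => B mB _; exact: (vol_translate v mB).
rewrite /nu /nu0 (integral_pushforward mt) //.
- by apply: eq_integral => x _ /=; rewrite subrK.
- exact/measurable_EFinP.
- apply: (bounded_integrable_rV (N := N) (M := M + \sum_i `|v ord0 i|)) => //.
  + by rewrite ltr_pwDl // sumr_ge0.
  + by apply: (eq_measurable_fun g) => // x _ /=; rewrite subrK.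
Qed.

Lemma cintegral_translate (v : 'rV[R]_d) (M : R) (Q : set 'rV[R]_d) f :
  0 < M -> measurable Q -> bounded_by M Q -> bmC f ->
  cintegral [set x | Q (x - v)] f = cintegral Q (fun x => f (x + v)).
Proof.
move=> M0 mQ QM [f1 f2 [N fN]]; rewrite /cintegral.
rewrite (Rintegral_translate (N := N) v M0 mQ QM f1) ?(Rintegral_translate (N := N) v M0 mQ QM f2) //.
  by move=> x; exact: (fN x).2.
by move=> x; exact: (fN x).1.
Qed.

Lemma cintegral_indic (D T : set 'rV[R]_d) f : T `<=` D ->
  cintegral D (fun x => Complex (\1_T x) 0 * f x) = cintegral T f.
Proof.
move=> TD; rewrite /cintegral -(setIidr TD) !Rintegral_mkcondr.
apply/eqP; rewrite eq_complex /=; apply/andP; split; apply/eqP.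
  apply: eq_Rintegral => x _; rewrite patchE indicE (setIidr TD).
  by case: (f x) => a b; case: (_ \in _) => /=; rewrite ?mul1r ?mul0r ?subr0.
apply: eq_Rintegral => x _; rewrite patchE indicE (setIidr TD).
by case: (f x) => a b; case: (_ \in _) => /=; rewrite ?mul1r ?mul0r ?addr0.
Qed.

(* The restriction of [e0] to the translate [Q + v]. *)
Definition piece (e0 : 'rV[R]_d -> R[i]) (v : 'rV[R]_d) (Q : set 'rV[R]_d) x : R[i] :=
  Complex (\1_[set x | Q (x - v)] x) 0 * e0 x.

(** For [e0 = e_ l0] and [e = e_ l] this is the Fourier transform of the indicator of [Q] at
    [l - l0]. *)
Definition coef (Q : set 'rV[R]_d) (e0 e : 'rV[R]_d -> R[i]) : R[i] :=
  cintegral Q (fun x => e0 x * (e x)^*).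

Section piece.
Variables (M : R) (D Q : set 'rV[R]_d) (v l0 : 'rV[R]_d).
Hypotheses (M0 : 0 < M) (mD : measurable D) (DM : bounded_by M D).
Hypotheses (mQ : measurable Q) (QM : bounded_by M Q).
Hypothesis QD : forall x, Q x -> D (x + v).

Let sub : [set x | Q (x - v)] `<=` D.
Proof. by move=> x /= /QD; rewrite subrK. Qed.

Let mQv : measurable [set x | Q (x - v)].
Proof. exact: measurable_preimage (measurable_translate v) mQ. Qed.

Lemma bmC_piece : bmC (piece (e_ l0) v Q).
Proof. by apply: bmCM; [exact: bmC_indic|exact: bmC_e_]. Qed.

(** Translating by [v] contributes only a unimodular factor independent of [Q]; it is common to two
    pieces moved by the same vector and disappears in [normsqC]. *)
Lemma inner_prod_piece l : inner_prod D (piece (e_ l0) v Q) (e_ l) =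
  (e_ l0 v * (e_ l v)^*) * coef Q (e_ l0) (e_ l).
Proof.
have b : bmC (fun x => e_ l0 x * (e_ l x)^*) by apply: bmCM; [|apply: bmC_conj]; exact: bmC_e_.
rewrite /inner_prod /piece; under [X in cintegral D X]eq_fun do rewrite -mulrA.
rewrite (cintegral_indic _ sub) (cintegral_translate v M0 mQ QM b) -(cintegralZ M0 mQ QM) //.
by congr cintegral; apply/funext => x; rewrite !e_D rmorphM /=; ring.
Qed.

Lemma normsq2_piece : normsq2 D (piece (e_ l0) v Q) = rvol Q.
Proof.
transitivity (\int[mu]_(x in D) \1_[set x | Q (x - v)] x).
  apply: eq_Rintegral => x _; rewrite /piece normsqCM normsqC_e_ mulr1 /normsqC /=.
  by rewrite expr0n addr0 indicE; case: (_ \in _); rewrite ?expr1n ?expr0n.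
rewrite /Rintegral integral_indic // setIidl //.
by congr fine; exact: (vol_translate v mQ).
Qed.

End piece.

Lemma normsq2_piece_orth (M : R) (D Q1 Q2 : set 'rV[R]_d) (v l0 : 'rV[R]_d) (z : R[i]) :
  0 < M -> measurable D -> bounded_by M D ->
  measurable Q1 -> measurable Q2 ->
  (forall x, Q1 x -> D (x + v)) -> (forall x, Q2 x -> D (x + v)) ->
  Q1 `&` Q2 = set0 -> normsqC z = 1 ->
  normsq2 D (fun x => piece (e_ l0) v Q1 x + z * piece (e_ l0) v Q2 x) = rvol Q1 + rvol Q2.
Proof.
move=> M0 mD DM m1 m2 Q1D Q2D Q12 z1.
rewrite -(normsq2_piece l0 mD m1 Q1D) -(normsq2_piece l0 mD m2 Q2D).
rewrite /normsq2 -RintegralD //; do ?by apply: (normsq_integrable M0 mD DM); exact: bmC_piece.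
apply: eq_Rintegral => x _; rewrite /piece.
have [h1|h1] := boolP (x \in [set x | Q1 (x - v)]).
  have h2 : x \notin [set x | Q2 (x - v)].
    apply/negP => h2; have : (Q1 `&` Q2) (x - v) by move: h1 h2; rewrite !inE.
    by rewrite Q12.
  rewrite !indicE h1 (negbTE h2) /= -[Complex 0 0]/(0 : R[i]) !mul0r mulr0 addr0.
  by rewrite [normsqC 0](_ : _ = 0) ?addr0 // /normsqC /= expr0n addr0.
rewrite !indicE (negbTE h1) /= -[Complex 0 0]/(0 : R[i]) mul0r add0r.
by rewrite [normsqC 0](_ : _ = 0) ?add0r ?normsqCM ?z1 ?mul1r // /normsqC /= expr0n addr0.
Qed.

End translated_pieces.

(** * The volume of the half difference body of a spectral set *)

Section spectral_packing.
Context {R : realType} (d : nat) (M : R) (D : set 'rV[R]_d).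
Hypotheses (M0 : 0 < M) (mD : measurable D) (DM : bounded_by M D).
Local Notation mu := (@lebesgue_measure_rV R d).

Lemma normsqC_sum (I : finType) (a : I -> R[i]) :
  normsqC (\sum_i a i) = \sum_i \sum_j complex.Re (a i * (a j)^*).
Proof.
have RI (s : seq I) : complex.Re (\sum_(i <- s) a i) = \sum_(i <- s) complex.Re (a i) /\
    complex.Im (\sum_(i <- s) a i) = \sum_(i <- s) complex.Im (a i).
  elim: s => [|i s [IH1 IH2]]; first by rewrite !big_nil.
  by rewrite !big_cons -IH1 -IH2; case: (a i) (\sum_(j <- s) a j) => ? ? [].
rewrite /normsqC; have [-> ->] := RI (index_enum I).
rewrite !expr2 !big_distrlr -big_split /=; apply: eq_bigr => i _.
rewrite -big_split /=; apply: eq_bigr => j _.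
by case: (a i) (a j) => p q [k l] /=; ring.
Qed.

Lemma coef_self Q (l : 'rV[R]_d) : measurable Q -> coef Q (e_ l) (e_ l) = Complex (rvol Q) 0.
Proof.
move=> mQ; rewrite /coef; have -> : (fun x => e_ l x * (e_ l x)^*) = cst (Complex 1 0).
  apply/funext => x; have := normsqC_e_ l x; case: (e_ l x) => a b; rewrite /normsqC /= => ab.
  apply/eqP; rewrite eq_complex /= -ab; apply/andP; split; apply/eqP; ring.
by rewrite /cintegral /cst /= !Rintegral_cst // mul1r mul0r.
Qed.

(* [v i j] moves both [Q i] and [Q j] into [D]; nothing is asked of the union of the pieces. *)
Lemma spectral_packing (I : finType) (Q : I -> set 'rV[R]_d) (v : I -> I -> 'rV[R]_d) :
  rvol D = 1 -> spectral D ->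
  (forall i, measurable (Q i)) -> (forall i, bounded_by M (Q i)) ->
  (forall i j, i != j -> Q i `&` Q j = set0) ->
  (forall i j x, Q i x \/ Q j x -> D (x + v i j)) ->
  \sum_i rvol (Q i) <= 1.
Proof.
move=> D1 [Lambda [_ [oE tE]]] mQ QM Q0 QD.
set E := [set e_ lambda | lambda in Lambda] in oE tE.
have bE u : E u -> bmC u by move=> [l _ <-]; exact: bmC_e_.
have QD1 i j x : Q i x -> D (x + v i j) by move=> Qx; apply: QD; left.
have QD2 i j x : Q j x -> D (x + v i j) by move=> Qx; apply: QD; right.
(* An empty system could not approximate the constant 1, whose squared norm is 1. *)
have [l0 El0] : exists l, E (e_ l).
  have [|s sE H] := total_approx M0 mD DM bE oE (h := fun=> Complex 1 0) tE (bmC_cst _ _)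
    (del := 2^-1); first by rewrite invr_gt0.
  case: s sE H => [_ /(_ [::] isT)|u s sE _]; last first.
    by have [l Ll _] : E u by [apply: sE; rewrite inE eqxx]; exists l; exists l.
  rewrite big_nil subr0 => H; have : normsq2 D (fun=> Complex 1 0) <= 2^-1 by apply: H.
  rewrite /normsq2 Rintegral_cst // -/(rvol D) D1 mulr1 /normsqC /= expr1n expr0n addr0.
  by lra.
pose V := \sum_i rvol (Q i); rewrite -/V.
have V0 : 0 <= V by apply: sumr_ge0 => i _; exact: rvol_ge0.
pose f1 i j := piece (e_ l0) (v i j) (Q i); pose f2 i j := piece (e_ l0) (v i j) (Q j).
have b1 i j : bmC (f1 i j) by exact: bmC_piece.
have b2 i j : bmC (f2 i j) by exact: bmC_piece.
pose w i u := coef (Q i) (e_ l0) u.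
have ipD i j z u : E u -> normsqC (inner_prod D (fun x => f1 i j x + z * f2 i j x) u) =
    normsqC (w i u + z * w j u).
  move=> [l Ll <-]; have bl := bmC_e_ l.
  rewrite (inner_prodD M0 mD DM) //; last exact: bmCZ.
  rewrite (inner_prodZ M0 mD DM) // /f1 /f2.
  rewrite (inner_prod_piece (M := M)) //; last exact: QD1.
  rewrite (inner_prod_piece (M := M)) //; last exact: QD2.
  set p := _ * _^*; rewrite mulrCA -mulrDr normsqCM /p normsqCM normsqC_conj !normsqC_e_.
  by rewrite !mul1r.
have main del : 0 < del -> V ^+ 2 <= V + #|I|%:R * (#|I|%:R * del).
  move=> d0.
  have /choice[L LP] : forall p : I * I, exists l : seq ('rV[R]_d -> R[i]),
      {in l, forall u, E u} /\
      forall s, uniq s -> {in s, forall u, E u} -> {subset l <= s} ->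
      normsq2 D (fun x => f1 p.1 p.2 x + (-1) * f2 p.1 p.2 x) -
        \sum_(u <- s) normsqC (inner_prod D (fun x => f1 p.1 p.2 x + (-1) * f2 p.1 p.2 x) u) <= del.
    move=> p; have bh : bmC (fun x => f1 p.1 p.2 x + (-1) * f2 p.1 p.2 x).
      by apply: bmCD => //; exact: bmCZ.
    by have [l lE H] := total_approx M0 mD DM bE oE tE bh d0; exists l.
  (* One finite family good for the differences of all pairs of pieces, and containing [e_ l0]. *)
  pose s := undup (e_ l0 :: flatten [seq L p | p <- enum {: I * I}]).
  have us : uniq s by exact: undup_uniq.
  have sE : {in s, forall u, E u}.
    move=> u; rewrite mem_undup inE => /orP[/eqP ->//|/flattenP[l /mapP[p _ ->]]].
    by move=> up; exact: (LP p).1.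
  have sub p : {subset L p <= s}.
    move=> u uL; rewrite mem_undup inE; apply/orP; right; apply/flattenP.
    by exists (L p) => //; apply: map_f; rewrite mem_enum.
  (* Sum and difference of the two disjoint pieces have the same squared norm. Bessel bounds the
     coefficients of the sum from above, completeness bounds those of the difference from below up
     to [del], and polarization subtracts the two. *)
  have pair i j : i != j -> \sum_(u <- s) complex.Re (w i u * (w j u)^*) <= del.
    move=> ij; have Qij := Q0 _ _ ij.
    have nE z : normsqC z = 1 ->
        normsq2 D (fun x => f1 i j x + z * f2 i j x) = rvol (Q i) + rvol (Q j).
      by move=> z1; apply: (normsq2_piece_orth l0 (M := M)) => //; [exact: QD1|exact: QD2].
    have n1 : normsqC (1 : R[i]) = 1 by rewrite /normsqC /= expr1n expr0n addr0.
    have nN1 : normsqC (- 1 : R[i]) = 1.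
      by rewrite /normsqC /= sqrrN expr1n oppr0 expr0n addr0.
    have := (LP (i, j)).2 s us sE (sub _); rewrite /= nE //.
    have := bessel M0 mD DM bE oE us sE (bmCD (b1 i j) (bmCZ 1 (b2 i j))); rewrite nE //.
    rewrite (eq_big_seq (fun u => normsqC (w i u + w j u))); last first.
      by move=> u /sE Eu; rewrite ipD // mul1r.
    rewrite [X in _ -> _ - X <= _ -> _](eq_big_seq (fun u => normsqC (w i u - w j u)));
      last first.
      by move=> u /sE Eu; rewrite ipD // mulN1r.
    have : \sum_(u <- s) normsqC (w i u + w j u) - \sum_(u <- s) normsqC (w i u - w j u) =
        4 * \sum_(u <- s) complex.Re (w i u * (w j u)^*).
      by rewrite -sumrB mulr_sumr; apply: eq_bigr => u _; rewrite normsqC_parallelogram.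
    set X := \sum_(u <- s) _; set Y := \sum_(u <- s) _; set Z := \sum_(u <- s) _ => ? ? ?.
    by lra.
  have diag i : \sum_(u <- s) complex.Re (w i u * (w i u)^*) <= rvol (Q i).
    have := bessel M0 mD DM bE oE us sE (b1 i i).
    rewrite (normsq2_piece l0 mD (mQ i)); last exact: QD1.
    congr (_ <= _); apply: eq_big_seq => u /sE [l Ll <-].
    rewrite /f1 (inner_prod_piece (M := M)) //; last exact: QD1.
    rewrite !normsqCM normsqC_conj !normsqC_e_ !mul1r.
    by rewrite -/(w i (e_ l)); case: (w i _) => a b; rewrite /normsqC /=; ring.
  have self : V ^+ 2 = normsqC (\sum_i w i (e_ l0)).
    have -> : \sum_i w i (e_ l0) = Complex V 0; last by rewrite /normsqC /= expr0n addr0.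
    rewrite /V; elim/big_ind2: _ => // [a [x y] a' [x' y'] [-> ->] [-> ->]|i _].
      by apply/eqP; rewrite eq_complex /= addr0 !eqxx.
    by rewrite /w coef_self.
  have e0s : e_ l0 \in s by rewrite mem_undup inE eqxx.
  rewrite self; apply: le_trans (_ : \sum_(u <- s) normsqC (\sum_i w i u) <= _).
    by rewrite (bigD1_seq _ e0s us) /= lerDl; apply: sumr_ge0 => u _; exact: normsqC_ge0.
  under eq_bigr do rewrite normsqC_sum.
  rewrite exchange_big /= /V.
  have -> : #|I|%:R * (#|I|%:R * del) = \sum_(i : I) (#|I|%:R * del).
    by rewrite sumr_const mulr_natl.
  rewrite -big_split /=; apply: ler_sum => i _; rewrite exchange_big /=.
  have -> : rvol (Q i) + #|I|%:R * del = \sum_(j : I) ((if j == i then rvol (Q i) else 0) + del).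
    by rewrite big_split /= -big_mkcond big_pred1_eq sumr_const mulr_natl.
  apply: ler_sum => j _; case: eqP => [->|/eqP ji].
    by apply: le_trans (diag i) _; rewrite lerDl ltW.
  by rewrite add0r; apply: pair; rewrite eq_sym.
have VV : V ^+ 2 <= V.
  apply/ler_addgt0Pr => e e0.
  have I0 : 0 < #|I|%:R + 1 :> R by rewrite ltr_wpDl.
  (* This makes the total error over all pairs at most [e]; the [+ 1] guards against an empty
     [I]. *)
  have d0 : 0 < e / (#|I|%:R + 1) ^+ 2 by rewrite divr_gt0 // exprn_gt0.
  apply: le_trans (main _ d0) _; rewrite lerD2l mulrA mulrCA ler_piMr ?ltW //.
  rewrite ltr_pdivrMr ?exprn_gt0 // mul1r.
  by have : 0 <= #|I|%:R :> R by []; set n := #|I|%:R; nra.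
rewrite leNgt; apply/negP => V1; have : V * 1 < V * V by rewrite ltr_pM2l // (lt_trans _ V1).
by move: VV; rewrite expr2 mulr1; lra.
Qed.

End spectral_packing.

(** * Grid partition of the half difference body *)

Section half_diff_volume.
Context {R : realType} (d : nat) (M : R) (D : set 'rV[R]_d).
Hypotheses (M0 : 0 < M) (oD : open D) (DM : bounded_by M D).
Hypothesis cD : forall x y t, D x -> D y -> 0 <= t <= 1 -> D (t *: x + (1 - t) *: y).
Local Notation mu := (@lebesgue_measure_rV R d).

Lemma rvol_finite_partition (I : finType) (K : set 'rV[R]_d) (Q : I -> set 'rV[R]_d) :
  bounded_by M K -> (forall i, measurable (Q i)) -> (forall i, Q i `<=` K) ->
  (forall x, K x -> exists i, Q i x) ->
  (forall i j, i != j -> Q i `&` Q j = set0) -> rvol K = \sum_i rvol (Q i).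
Proof.
move=> KM mQ QK KQ Q0.
have -> : K = \bigcup_(i in [set: I]) Q i.
  by apply/seteqP; split => [x /KQ[i Qx]|x [i _ /QK]//]; exists i.
apply: EFin_inj; rewrite -sumEFin (rvolK M0); last 2 first.
- by apply: fin_bigcup_measurable => //; exact: finite_finset.
- by move=> x [i _ /QK]; exact: KM.
rewrite measure_fin_bigcup //; last 2 first.
- exact: finite_finset.
- by apply/trivIsetP => i j _ _; exact: Q0.
rewrite (fsbigE (index_enum I)) ?index_enum_uniq //; last by move=> i _;
  rewrite mem_index_enum.
apply: eq_big => [i|i _]; first by rewrite mem_set.
by rewrite (rvolK M0) // => x /QK; exact: KM.
Qed.

(** The body is cut along a grid whose mesh [e] is the margin of [inner D k]. Each nonempty piece
    [Q s] is represented by one of its points [(p - q) / 2], and the halved sums of the [q] serve as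
    translations in [spectral_packing]. *)
Lemma rvol_half_diff_inner_le1 k : rvol D = 1 -> spectral D ->
  rvol (half_diff (inner D k)) <= 1.
Proof.
move=> D1 sD; set e : R := k.+1%:R^-1.
have e0 : 0 < e by rewrite invr_gt0.
pose K := half_diff (inner D k); rewrite -/K.
have oK : open K by apply: open_half_diff; exact: open_inner.
have KM : bounded_by M K.
  by apply: bounded_by_half_diff => x /inner_sub; exact: DM.
have [K0|/set0P[z0 [x0 [_ [Ax0 _ _]]]]] := eqVneq K set0.
  by rewrite K0 rvol0.
(* Coordinates shifted by [M] range over [[0, 2 * M]], which the half-open cells numbered from 0 to
   [B] cover without overlap. *)
pose B := Num.truncn (2 * M / e).
pose cell (s : {ffun 'I_d -> 'I_B.+1}) := [set x : 'rV[R]_d | forall i,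
  (s i)%:R * e <= x ord0 i + M < (s i)%:R * e + e].
pose Q s := K `&` cell s.
have mQ s : measurable (Q s).
  apply: measurableI; first exact: open_measurable_rV.
  suff -> : cell s = \bigcap_(i in [set: 'I_d]) ((fun x : 'rV[R]_d => x ord0 i) @^-1`
       `[(s i)%:R * e - M, (s i)%:R * e + e - M[%classic).
    apply: fin_bigcap_measurable => [|i _]; first exact: finite_finset.
    by apply: measurable_preimage => //; exact: measurable_coord_rV.
  apply/seteqP; split => [x xs i _|x xs i]; have := xs i; rewrite /= in_itv /=.
    by rewrite lerBlDr ltrBrDr.
  by rewrite lerBlDr ltrBrDr; exact.
have KQ x : K x -> exists s, Q s x.
  move=> Kx; have xM i : 0 <= x ord0 i + M <= 2 * M.
    by have := KM x Kx i; rewrite ler_norml => /andP[? ?]; apply/andP; split; lra.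
  have tr i : (Num.truncn ((x ord0 i + M) / e) < B.+1)%N.
    rewrite ltnS /B; apply: le_truncn; rewrite ler_pM2r ?invr_gt0 //.
    by case/andP: (xM i).
  exists [ffun i => Ordinal (tr i)]; split => // i; rewrite ffunE /=.
  have /andP[xi0 _] := xM i.
  have h0 : 0 <= (x ord0 i + M) / e by rewrite divr_ge0 // ltW.
  apply/andP; split; first by rewrite -ler_pdivlMr // truncn_le.
  rewrite -{3}(mul1r e) -mulrDl natr1 -ltr_pdivrMr //.
  exact: truncnS_gt.
have Qclose s x y i : Q s x -> Q s y -> `|x ord0 i - y ord0 i| < e.
  move=> [_ /(_ i)/andP[? ?]] [_ /(_ i)/andP[? ?]].
  by rewrite ltr_norml; apply/andP; split; lra.
have Q0 s t : s != t -> Q s `&` Q t = set0.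
  move=> st; apply/seteqP; split => // x [[_ xs] [_ xt]]; move/negP: st; apply.
  apply/eqP/ffunP => i; apply: val_inj => /=.
  have /andP[a1 a2] := xs i; have /andP[b1 b2] := xt i.
  have lt_ (m n : nat) : m%:R * e < n%:R * e + e -> (m <= n)%N.
    by rewrite -{3}(mul1r e) -mulrDl natr1 ltr_pM2r // ltr_nat ltnS.
  by apply/eqP; rewrite eqn_leq (lt_ _ _ (le_lt_trans a1 b2)) (lt_ _ _ (le_lt_trans b1 a2)).
(* For an empty piece the closeness condition is void, and the default pair [(x0, x0)] keeps both
   entries in [inner D k]. *)
have /choice[pq pqP] : forall s, exists pq : 'rV[R]_d * 'rV[R]_d,
    [/\ inner D k pq.1, inner D k pq.2 &
      forall x, Q s x -> forall i, `|x ord0 i - (2^-1 *: (pq.1 - pq.2)) ord0 i| < e].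
  move=> s; have [Qs0|/set0P[c Qc]] := eqVneq (Q s) set0.
    by exists (x0, x0); split => // x; rewrite Qs0.
  have [[p [q [Dp Dq cE]]] _] := Qc.
  by exists (p, q); split => // x Qx i /=; rewrite -cE; exact: Qclose Qx Qc.
rewrite (rvol_finite_partition KM mQ (fun s x h => h.1) KQ Q0).
apply: (spectral_packing M0 (open_measurable_rV oD) DM
  (v := fun s t => 2^-1 *: ((pq s).2 + (pq t).2)) D1 sD mQ _ Q0).
  by move=> s x [/KM].
(* The margin absorbs [dx] at both end points, and convexity of [D] handles their midpoint. It will
   be used with [p] from one piece and [q] from another. *)
have near (p q dx : 'rV[R]_d) : inner D k p -> inner D k q -> (forall i, `|dx ord0 i| < e) ->
    D (2^-1 *: (p + q) + dx).
  move=> [ep kp Dp] [eq kq Dq] dxe.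
  have := cD (t := 2^-1) (Dp (p + dx) _) (Dq (q + dx) _).
  have -> : 2^-1 *: (p + dx) + (1 - 2^-1) *: (q + dx) = 2^-1 *: (p + q) + dx.
    by apply/rowP => i; rewrite !mxE; field.
  apply.
  - by move=> i; rewrite mxE addrAC subrr add0r; exact: lt_trans (dxe i) kp.
  - by move=> i; rewrite mxE addrAC subrr add0r; exact: lt_trans (dxe i) kq.
  - by apply/andP; split; lra.
move=> s t x [Qx|Qx].
  have [Dp Dq xe] := pqP s; have [_ Dq' _] := pqP t.
  have := near _ _ (x - 2^-1 *: ((pq s).1 - (pq s).2)) Dp Dq'.
  have -> : 2^-1 *: ((pq s).1 + (pq t).2) + (x - 2^-1 *: ((pq s).1 - (pq s).2)) =
     x + 2^-1 *: ((pq s).2 + (pq t).2) by apply/rowP => i; rewrite !mxE; ring.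
  by apply => i; have := xe x Qx i; rewrite !mxE.
have [Dp Dq xe] := pqP t; have [_ Dq' _] := pqP s.
have := near _ _ (x - 2^-1 *: ((pq t).1 - (pq t).2)) Dp Dq'.
have -> : 2^-1 *: ((pq t).1 + (pq s).2) + (x - 2^-1 *: ((pq t).1 - (pq t).2)) =
   x + 2^-1 *: ((pq s).2 + (pq t).2) by apply/rowP => i; rewrite !mxE; ring.
by apply => i; have := xe x Qx i; rewrite !mxE.
Qed.

(** Continuity from below along the exhaustion of [D] by the sets [inner D k]. *)
Lemma rvol_half_diff_le1 : rvol D = 1 -> spectral D -> rvol (half_diff D) <= 1.
Proof.
move=> D1 sD; rewrite leNgt; apply/negP => lt1.
pose K k := half_diff (inner D k).
have oK k : open (K k) by apply: open_half_diff; exact: open_inner.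
have mK k : measurable (K k) := open_measurable_rV (oK k).
have KM k : bounded_by M (K k).
  by apply: bounded_by_half_diff => x /inner_sub; exact: DM.
have KU : \bigcup_k K k = half_diff D.
  apply/seteqP; split => [z [k _ [x [y [Dx Dy ->]]]]|z [x [y [Dx Dy ->]]]].
    by exists x, y; split; [exact: inner_sub Dx|exact: inner_sub Dy|].
  move: Dx Dy; rewrite -(bigcup_inner oD) => -[i _ Dx] [j _ Dy].
  exists (maxn i j) => //; exists x, y; split => //.
    by apply: subset_inner Dx; exact: leq_maxl.
  by apply: subset_inner Dy; exact: leq_maxr.
have ndK : nondecreasing_seq K.
  move=> i j ij; apply/subsetPset => _ [x [y [Dx Dy ->]]].
  by exists x, y; split; [exact: subset_inner ij _ Dx|exact: subset_inner ij _ Dy|].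
have := nondecreasing_cvg_mu (mu := mu) mK (bigcup_measurable (fun k _ => mK k)) ndK.
have lt1' : (1%:E < mu (half_diff D))%E.
  rewrite -(rvolK M0) ?lte_fin //; last exact: bounded_by_half_diff.
  exact: open_measurable_rV (open_half_diff oD).
rewrite KU => /(_ _ (open_ereal_gt' lt1'))[k _ /(_ k (leqnn k))] /=.
rewrite -(rvolK M0 (mK k) (KM k)) lte_fin ltNge.
by rewrite rvol_half_diff_inner_le1.
Qed.

End half_diff_volume.

Theorem theorem1 (R : realType) (d : nat) (Omega : set 'rV[R]_d)
    (Omega_convex : convex_set Omega)
    (Omega_nonsym : non_symmetric Omega)
    (Omega_bounded : bounded_set Omega)
    (Omega_open : open Omega)
    (Omega_measure1 : lebesgue_measure_rV d Omega = 1%E) :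
  ~ spectral Omega.
Proof.
move=> sO; have [M M0 OM] := bounded_coordP Omega_bounded.
have cO := convex_setP Omega_convex.
have vO : rvol Omega = 1 by rewrite /rvol Omega_measure1.
have := rvol_half_diff_le1 M0 Omega_open OM cO vO sO.
(* The centroid is defined in positive dimension. In dimension 0 the space is a single point, so
   every set is symmetric. *)
case: d => [|n] in Omega Omega_convex Omega_nonsym Omega_bounded Omega_open
    Omega_measure1 sO OM cO vO * => le1.
  by apply: (Omega_nonsym 0) => y Oy; rewrite (thinmx0 (_ - _)) -(thinmx0 y).
apply: (Omega_nonsym (centroid Omega)).
by apply: (half_diff_equality_symmetric M0) => //; rewrite vO.
Qed.
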